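(* There is a unique $\mathfrak{H}$-module structure on $M$ (extending its $\mathcal{A}$-module structure) such that for any $s\in S$ and any $w\in \mathbf{I}_*$ we have: (i) $T_s a_w = u a_w + (u+1)a_{sw}$ if $sw = ws^* > w$; (ii) $T_s a_w = (u^2-u-1)a_w + (u^2-u)a_{sw}$ if $sw = ws^* < w$; (iii) $T_s a_w = a_{sws^*}$ if $sw\ne ws^* $ and $sw> w$; (iv) $T_s a_w = (u^2-1)a_w + u^2 a_{sws^*}$ if $sw\neq ws^*$ and $sw< w$.
   Context: $W$ is a Coxeter group with set of simple reflections $S$, length function $l:W\to\mathbf{N}$ and Bruhat order $\le$. $w\mapsto w^*$ is an automorphism of $W$ with square $1$ which leaves $S$ stable. $\mathbf{I}_*=\{w\in W : (w^* )^{-1}=w\}$ (the $*$-twisted involutions). $u$ is an indeterminate and $\mathcal{A}=\mathbf{Z}[u,u^{-1}]$. $\mathfrak{H}$ is the free $\mathcal{A}$-module with basis $(T_w)_{w\in W}$ with the unique $\mathcal{A}$-algebra structure with unit $T_1$ such that $T_wT_{w'}=T_{ww'}$ if $l(ww')=l(w)+l(w')$, and $(T_s+1)(T_s-u^2)=0$ for all $s\in S$. $M$ is the free $\mathcal{A}$-module with basis $\{a_w : w\in\mathbf{I}_*\}$. *)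

(* Defs.v *)
From HB Require Import structures.
From Stdlib Require Export Relation_Operators.
From mathcomp Require Export all_boot all_algebra.
From mathcomp Require Export boolp classical_sets.

Set Implicit Arguments.
Unset Strict Implicit.
Unset Printing Implicit Defensive.

Import GRing.Theory.
Local Open Scope ring_scope.

(* The ring Z[u, u^-1], realized as the subring of the fractions of Z[X] that
   become polynomials after multiplication by some power of X. *)
Definition laurent_pred : {pred {fraction {poly int}}} :=
  fun x => `[< exists (n : nat) (p : {poly int}),
                 x * tofrac 'X ^+ n = tofrac p >].

Lemma laurent_subring : subring_closed laurent_pred.
Proof.
split.
- by apply/asboolP; exists 0%N, 1; rewrite expr0 mulr1 rmorph1.
- move=> x y /asboolP[n [p hp]] /asboolP[m [q hq]]; apply/asboolP.
  exists (n + m)%N, (p * 'X ^+ m - q * 'X ^+ n).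
  rewrite exprD mulrBl mulrA hp mulrCA hq mulrC.
  by rewrite rmorphB !rmorphM !rmorphXn /= [tofrac 'X ^+ n * _]mulrC
             [_ * tofrac p]mulrC.
- move=> x y /asboolP[n [p hp]] /asboolP[m [q hq]]; apply/asboolP.
  by exists (n + m)%N, (p * q); rewrite exprD mulrACA hp hq rmorphM.
Qed.

HB.instance Definition _ :=
  GRing.isSubringClosed.Build {fraction {poly int}} laurent_pred
    laurent_subring.

Record laurent := Laurent {
  laurent_val : {fraction {poly int}};
  laurent_valP : laurent_val \in laurent_pred
}.

HB.instance Definition _ := [isSub for laurent_val].
HB.instance Definition _ := [Choice of laurent by <:].
HB.instance Definition _ := [SubChoice_isSubComNzRing of laurent by <:].

Lemma laurent_u_subproof : tofrac ('X : {poly int}) \in laurent_pred.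
Proof. by apply/asboolP; exists 0%N, 'X; rewrite expr0 mulr1. Qed.

Definition laurent_u : laurent := Laurent laurent_u_subproof.

(* The vectors b i, for i satisfying D, form a basis; the values of b outside D
   are irrelevant. *)
Record basis_on (R : nzRingType) (V : lmodType R) (I : eqType)
    (D : {pred I}) (b : I -> V) : Prop := BasisOn {
  basis_free : forall (r : seq I) (c : I -> R),
    uniq r -> {subset r <= D} ->
    \sum_(i <- r) c i *: b i = 0 -> forall i, i \in r -> c i = 0;
  basis_span : forall v : V, exists (r : seq I) (c : I -> R),
    {subset r <= D} /\ v = \sum_(i <- r) c i *: b i
}.

Section Coxeter.
Local Open Scope group_scope.
Variables (W : groupType) (S : {pred W}).

Definition is_expression (w : W) (r : seq W) : Prop :=
  {subset r <= S} /\ \prod_(s <- r) s = w.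

(* The last field is the universal property of the presentation of W by the
   generators S and the relations (s t)^n = 1, for s, t in S; as the relation
   for the order m(s, t) implies the others, n ranges over all exponents for
   which the relation holds in W. *)
Record coxeter_system : Prop := CoxeterSystem {
  coxeter_gen : forall w : W, exists r : seq W, is_expression w r;
  coxeter_order2 : forall s, s \in S -> s != 1 /\ s * s = 1;
  coxeter_universal : forall (G : groupType) (f : W -> G),
    (forall s t (n : nat), s \in S -> t \in S ->
       (s * t) ^+ n = 1 -> (f s * f t) ^+ n = 1) ->
    exists phi : {multiplicative W -> G}, forall s, s \in S -> phi s = f s
}.

Definition cox_length (w : W) : nat :=
  xget 0%N (fun n : nat =>
    (exists2 r, is_expression w r & size r = n) /\
    (forall r, is_expression w r -> (n <= size r)%N)).

Definition is_reflection (t : W) : Prop :=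
  exists (x s : W), s \in S /\ t = x * s * x^-1.

Definition bruhat_step (x y : W) : Prop :=
  (exists2 t, is_reflection t & y = x * t) /\
  (cox_length x < cox_length y)%N.

Definition bruhat_le : W -> W -> Prop := clos_refl_trans W bruhat_step.

Definition bruhat_lt (x y : W) : Prop := bruhat_le x y /\ x <> y.

Definition twisted_involution (star : W -> W) : {pred W} :=
  fun w => (star w)^-1 == w.

End Coxeter.

(* H, with the family T, is the Hecke algebra of (W, S) with parameter u^2. *)
Record hecke_algebra (W : groupType) (S : {pred W}) (H : algType laurent)
    (T : W -> H) : Prop := HeckeAlgebra {
  hecke_basis : basis_on predT T;
  hecke_one : T 1%g = 1;
  hecke_mul : forall w w' : W,
    cox_length S (w * w')%g = (cox_length S w + cox_length S w')%N ->
    T w * T w' = T (w * w')%g;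
  hecke_quadratic : forall s, s \in S ->
    (T s + 1) * (T s - (laurent_u ^+ 2)%:A) = 0
}.

(* The axiom act 1 m = m is the case c = 1 of module_scale. *)
Record module_structure (R : comNzRingType) (H : algType R) (M : lmodType R)
    (act : H -> M -> M) : Prop := ModuleStructure {
  module_addl : forall h h' m, act (h + h') m = act h m + act h' m;
  module_addr : forall h m m', act h (m + m') = act h m + act h m';
  module_mul : forall h h' m, act (h * h') m = act h (act h' m);
  module_scale : forall (c : R) m, act c%:A m = c *: m
}.

(* Main.v *)
From HB Require Import structures.
Require Import Defs.
From mathcomp Require Import zify ring.

(* Let r_s be the operator on M prescribed by (i)-(iv) and put q = u^2.  A direct
   check gives (r_s + 1)(r_s - q) = 0, so by Matsumoto's theorem it remains to prove
   the braid relations; Matsumoto's theorem comes from the exchange condition, which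
   in turn comes from letting W act on W x {+1,-1} by
   s.(x, e) = (s x s^-1, e (-1)^[x = s]).

   For s <> t with st of order m, let D_k be the difference of the two alternating
   products of length k of r_s and r_t.  The kernel of D_m is stable under r_s and
   r_t, and u + 1 is a nonzerodivisor, so it is enough to prove D_m a_b = 0 when b
   has minimal length in <s,t>b: every other a_w is reached from such elements by (i)
   and (iii).  The quadratic relation gives
     D_(k+1) = (r_s + r_t - (q - 1)) D_k - q D_(k-1),   D_0 = 0,
   a recurrence which is symmetric under reversing k up to powers of q.  Climbing from
   b to the top of its orbit, which takes about m/2 steps when <s,t>b = b<s*,t*>,
   yields a relation between D_k a_b and D_(k+1) a_b or D_(k+2) a_b with k close to
   m/2; reflecting the recurrence there turns D_0 = 0 into D_m a_b = 0.  When
   <s,t>b <> b<s*,t*>, both products of length m are computed outright. *)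

Set Implicit Arguments.
Unset Strict Implicit.
Unset Printing Implicit Defensive.

Import GRing.Theory.

(** * Linear expressions *)

Section LinearExpressions.
Local Open Scope ring_scope.
Variables (R : comNzRingType) (M : lmodType R).

Inductive lexpr :=
  | LVar of nat
  | LZero
  | LAdd of lexpr & lexpr
  | LOpp of lexpr
  | LScale of R & lexpr.

Fixpoint leval (env : seq M) e : M :=
  match e with
  | LVar i => env`_i
  | LZero => 0
  | LAdd e1 e2 => leval env e1 + leval env e2
  | LOpp e1 => - leval env e1
  | LScale c e1 => c *: leval env e1
  end.

(** The index test uses [eqn], which [cbn] reduces on numerals, so that [ring] sees nothing but
    coefficients. *)
Fixpoint lcoef (i : nat) e : R :=
  match e with
  | LVar j => if eqn i j then 1 else 0
  | LZero => 0
  | LAdd e1 e2 => lcoef i e1 + lcoef i e2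
  | LOpp e1 => - lcoef i e1
  | LScale c e1 => c * lcoef i e1
  end.

Lemma leval_coef env e : leval env e = \sum_(i < size env) lcoef i e *: env`_i.
Proof.
elim: e => [j||e1 IH1 e2 IH2|e1 IH1|c e1 IH1] /=.
- have [lt|ge] := ltnP j (size env); last first.
    rewrite nth_default // big1 // => i _; rewrite eqnE.
    by rewrite ltn_eqF ?scale0r // (leq_trans _ ge).
  rewrite (bigD1 (Ordinal lt)) // big1 => [|i]; rewrite /= eqnE ?eqxx ?scale1r ?addr0 //.
  by rewrite -val_eqE /= => /negPf ->; rewrite scale0r.
- by rewrite big1 // => i _; rewrite scale0r.
- by rewrite IH1 IH2 -big_split; apply: eq_bigr => i _; rewrite scalerDl.
- by rewrite IH1 -sumrN; apply: eq_bigr => i _; rewrite scaleNr.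
by rewrite IH1 scaler_sumr; apply: eq_bigr => i _; rewrite scalerA.
Qed.

Fixpoint lcoef_eq (n : nat) e1 e2 : Prop :=
  if n is n'.+1 then lcoef n' e1 = lcoef n' e2 /\ lcoef_eq n' e1 e2 else True.

Lemma leval_eq env e1 e2 : lcoef_eq (size env) e1 e2 -> leval env e1 = leval env e2.
Proof.
move=> eq12; rewrite !leval_coef; apply: eq_bigr => i _; congr (_ *: _).
elim: (size env) i eq12 => [|n IHn] i /=; first by case: i.
case=> En /IHn eq12; have := ltn_ord i; rewrite ltnS leq_eqVlt => /predU1P[-> //|lt].
exact: (eq12 (Ordinal lt)).
Qed.

End LinearExpressions.

(* [lmodule] decides identities between linear combinations with coefficients in
   a commutative ring by comparing coefficients with [ring]. *)
Ltac lm_index x env :=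
  lazymatch env with
  | ?y :: ?env' =>
    match constr:(tt) with
    | _ => let _ := match constr:(tt) with _ => unify x y end in constr:(0%N)
    | _ => let n := lm_index x env' in constr:(n.+1)
    end
  end.

Ltac lm_insert x env :=
  match env with
  | _ => let n := lm_index x env in env
  | _ => constr:(x :: env)
  end.

Ltac lm_atoms e env :=
  lazymatch e with
  | (?a + ?b)%R => let env' := lm_atoms a env in lm_atoms b env'
  | (- ?a)%R => lm_atoms a env
  | (_ *: ?a)%R => lm_atoms a env
  | 0%R => env
  | _ => lm_insert e env
  end.

Ltac lm_reify R e env :=
  lazymatch e with
  | (?a + ?b)%R =>
    let a' := lm_reify R a env in let b' := lm_reify R b env in
    constr:(@LAdd R a' b')
  | (- ?a)%R => let a' := lm_reify R a env in constr:(@LOpp R a')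
  | (?c *: ?a)%R => let a' := lm_reify R a env in constr:(@LScale R c a')
  | 0%R => constr:(@LZero R)
  | _ => let n := lm_index e env in constr:(@LVar R n)
  end.

Ltac lmodule R :=
  lazymatch goal with
  | |- @eq ?M ?a ?b =>
    let env0 := lm_atoms a (@nil M) in
    let env := lm_atoms b env0 in
    let a' := lm_reify R a env in
    let b' := lm_reify R b env in
    apply: (@leval_eq R _ env a' b');
    cbn [lcoef_eq lcoef eqn size]; repeat split; ring
  end.

(** * Coxeter groups and the exchange condition *)

(** Permutations of a possibly infinite type, with the inverse as data. They form the group to which
    [coxeter_universal] is applied, for X = [W * bool]. *)
Record bijection (X : Type) := Bijection {
  bij_fun : X -> X;
  bij_inv : X -> X;
  bij_funK : cancel bij_fun bij_inv;
  bij_invK : cancel bij_inv bij_fun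
}.

Section BijectionGroup.
Variable X : Type.
Implicit Types f g h : bijection X.

Lemma bijection_eq f g : bij_fun f =1 bij_fun g -> f = g.
Proof.
case: f => f f' fK f'K; case: g => g g' gK g'K /= /funext efg.
subst g; have efg' : f' = g' by apply/funext => x; rewrite -{1}[x]g'K fK.
by subst g'; congr Bijection; exact: Prop_irrelevance.
Qed.

HB.instance Definition _ := gen_eqMixin (bijection X).
HB.instance Definition _ := gen_choiceMixin (bijection X).

Definition bij_one : bijection X := @Bijection X id id (fun=> erefl) (fun=> erefl).
Definition bij_opp f : bijection X := Bijection (@bij_invK X f) (@bij_funK X f).
Definition bij_mul f g : bijection X :=
  Bijection (can_comp (@bij_funK X f) (@bij_funK X g))
            (can_comp (@bij_invK X g) (@bij_invK X f)).

Lemma bij_mulA : associative bij_mul.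
Proof. by move=> f g h; apply: bijection_eq. Qed.
Lemma bij_mul1 : left_id bij_one bij_mul.
Proof. by move=> f; apply: bijection_eq. Qed.
Lemma bij_mulr1 : right_id bij_one bij_mul.
Proof. by move=> f; apply: bijection_eq. Qed.
Lemma bij_mulV : left_inverse bij_one bij_opp bij_mul.
Proof. by move=> f; apply: bijection_eq => x /=; rewrite bij_funK. Qed.
Lemma bij_mulrV : right_inverse bij_one bij_opp bij_mul.
Proof. by move=> f; apply: bijection_eq => x /=; rewrite bij_invK. Qed.

HB.instance Definition _ := isGroup.Build (bijection X)
  bij_mulA bij_mul1 bij_mulr1 bij_mulV bij_mulrV.

Lemma bij_mulE f g x : bij_fun (f * g)%g x = bij_fun f (bij_fun g x).
Proof. by []. Qed.

End BijectionGroup.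

Section MultiplicativeGroups.
Local Open Scope group_scope.
Variables (G H : groupType) (f : {multiplicative G -> H}).

Lemma multiplicative1 : f 1 = 1.
Proof. by apply: (@mulgI _ (f 1)); rewrite -gmulfM !mulg1. Qed.

Lemma multiplicativeV x : f x^-1 = (f x)^-1.
Proof.
by apply: (@mulgI _ (f x)); rewrite -gmulfM !mulgV multiplicative1.
Qed.

End MultiplicativeGroups.

(** * Words, length and the exchange condition *)

Section Words.
Local Open Scope group_scope.
Variables (W : groupType) (S : {pred W}).
Hypothesis cox : coxeter_system S.

Local Notation len := (cox_length S).
Local Notation wprod r := (\prod_(x <- r) x).

Lemma cox_invol s : s \in S -> s * s = 1.
Proof. by case/(coxeter_order2 cox). Qed.

Lemma cox_inv s : s \in S -> s^-1 = s.
Proof. by move=> /cox_invol; apply: mulg1_eq. Qed.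

Lemma cox_mulK s w : s \in S -> s * (s * w) = w.
Proof. by move=> sS; rewrite mulgA cox_invol ?mul1g. Qed.

Lemma wprod_cat (p q : seq W) : wprod (p ++ q) = wprod p * wprod q.
Proof. by rewrite big_cat. Qed.

Lemma wprod_rcons (p : seq W) x : wprod (rcons p x) = wprod p * x.
Proof. by rewrite -cats1 wprod_cat big_seq1. Qed.

Lemma wprod_rev (p : seq W) : all [in S] p -> wprod (rev p) = (wprod p)^-1.
Proof.
elim: p => [|s p IHp] /=; first by rewrite big_nil invg1.
by case/andP=> sS /IHp pV; rewrite rev_cons wprod_rcons big_cons invgM pV (cox_inv sS).
Qed.

Lemma word_exists w : exists2 p, all [in S] p & wprod p = w.
Proof. by have [p [/allP pS <-]] := coxeter_gen cox w; exists p. Qed.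

Lemma lenP w : (exists2 p, all [in S] p /\ wprod p = w & size p = len w) /\
  (forall p, all [in S] p -> wprod p = w -> len w <= size p)%N.
Proof.
pose P n := `[< exists2 p, is_expression S w p & size p = n >].
have exP : exists n, P n.
  by have [p pw] := coxeter_gen cox w; exists (size p); apply/asboolP; exists p.
rewrite /cox_length; case: xgetP => [n _ [[p [/allP pS pw] pn] nmin]|].
  split; first by exists p.
  by move=> q /allP qS qw; apply: nmin.
(* The default value of [xget] never occurs: the least size of an expression satisfies the defining
   property. *)
case: (ex_minnP exP) => n /asboolP nP nmin /(_ n) [].
split=> // p pw; apply: nmin.
by apply/asboolP; exists p.
Qed.

Lemma len_word w : exists2 p, all [in S] p /\ wprod p = w & size p = len w.
Proof. by case: (lenP w). Qed.

Lemma len_wprod p : all [in S] p -> (len (wprod p) <= size p)%N.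
Proof. by move=> pS; case: (lenP (wprod p)) => _; apply. Qed.

Lemma len1 : len 1 = 0%N.
Proof. by apply/eqP; rewrite -leqn0; have := @len_wprod [::] isT; rewrite big_nil. Qed.

Lemma lenM_le w w' : (len (w * w') <= len w + len w')%N.
Proof.
have [p [pS <-] <-] := len_word w; have [q [qS <-] <-] := len_word w'.
by rewrite -wprod_cat -size_cat len_wprod // all_cat pS.
Qed.

Lemma lenV w : len w^-1 = len w.
Proof.
suff le_len v : (len v^-1 <= len v)%N.
  by apply/eqP; rewrite eqn_leq le_len -{1}[w]invgK le_len.
have [p [pS <-] <-] := len_word v.
by rewrite -wprod_rev // -size_rev len_wprod // all_rev.
Qed.

(** The boolean is the sign. The map is invertible for every [s] in W, as [coxeter_universal] takes
    a function on all of W. *)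
Definition toggle (s : W) (xe : W * bool) := (s * xe.1 * s^-1, xe.2 (+) (xe.1 == s)).
Definition untoggle (s : W) (xe : W * bool) :=
  (s^-1 * xe.1 * s, xe.2 (+) (s^-1 * xe.1 * s == s)).

Lemma toggleK s : cancel (toggle s) (untoggle s).
Proof.
by case=> x e; rewrite /toggle /untoggle /= !mulgA mulVg mul1g mulgVK -addbA addbb addbF.
Qed.

Lemma untoggleK s : cancel (untoggle s) (toggle s).
Proof.
by case=> x e; rewrite /toggle /untoggle /= !mulgA mulgV mul1g mulgK -addbA addbb addbF.
Qed.

Definition toggle_bij s : bijection (W * bool)%type :=
  Bijection (toggleK s) (untoggleK s).

(* The reflections crossed by the word (st)^k are (ts)^i t for i < 2k; when
   (st)^n = 1 each of them is crossed an even number of times. *)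
Lemma toggle_expg s t k x e : s \in S -> t \in S ->
  bij_fun ((toggle_bij s * toggle_bij t) ^+ k) (x, e) =
  ((s * t) ^+ k * x * (t * s) ^+ k,
   e (+) odd (\sum_(i < k.*2) (x == (t * s) ^+ i * t)%g)%N).
Proof.
move=> sS tS.
have stV : s * t = (t * s)^-1 by rewrite invgM (cox_inv sS) (cox_inv tS).
have stK j : (s * t) ^+ j * (t * s) ^+ j = 1.
  by rewrite stV expVgn mulVg.
have tsK j : (t * s) ^+ j * (s * t) ^+ j = 1.
  by rewrite stV expVgn mulgV.
have tsC j : t * (s * t) ^+ j = (t * s) ^+ j * t.
  elim: j => [|j IHj]; first by rewrite !expg0 mulg1 mul1g.
  by rewrite expgSr mulgA IHj expgSr !mulgA.
elim: k => [|k IHk]; first by rewrite !expg0 big_ord0 mul1g mulg1 addbF.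
rewrite expgS !bij_mulE IHk /= /toggle /=; congr pair.
  by rewrite !cox_inv // expgS expgSr !mulgA.
have conj_eq (g h y z : W) : g * h = 1 -> h * g = 1 -> (g * y * h == z) = (y == h * z * g).
  move=> gh hg; rewrite -(inj_eq (mulgI h)) -(inj_eq (@mulIg _ g)).
  by rewrite !mulgA hg mul1g -mulgA hg mulg1.
(* The new indices 2k and 2k + 1 come from the factors [t] and [s] respectively. *)
rewrite doubleS !big_ord_recr /= !oddD !addbA !oddb; congr (_ (+) _ (+) _).
  by rewrite conj_eq // -mulgA tsC mulgA -expgnDr addnn.
rewrite cox_inv // conj_eq ?cox_invol // conj_eq //.
by rewrite -!mulgA tsC [s * (_ * t)]mulgA [t * (_ * _)]mulgA [t * (s * _)]mulgA -expgS
           mulgA -expgnDr -addnn addnS.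
Qed.

Lemma toggle_rel s t n : s \in S -> t \in S -> (s * t) ^+ n = 1 ->
  (toggle_bij s * toggle_bij t) ^+ n = 1.
Proof.
move=> sS tS stn; apply: bijection_eq => -[x e].
have tsn : (t * s) ^+ n = 1.
  by rewrite -[t]cox_inv // -[s]cox_inv // -invgM expVgn stn invg1.
rewrite toggle_expg // stn tsn mul1g mulg1 -addnn big_split_ord /=.
under [X in (_ + X)%N]eq_bigr => i _ do rewrite expgnDr tsn mul1g.
by rewrite oddD addbb addbF.
Qed.

(* eta w x is the parity of the number of times a word for w crosses the reflection x. *)
Lemma inversion_parity : exists eta : W -> W -> bool,
  (forall s x, s \in S -> eta s x = (x == s)) /\
  (forall w w' x, eta (w * w') x = eta w x (+) eta w' (w^-1 * x * w)).
Proof.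
have [phi phiS] := coxeter_universal cox toggle_rel.
have phiM w w' x : bij_fun (phi (w * w')) x = bij_fun (phi w) (bij_fun (phi w') x).
  by rewrite gmulfM.
(* The action commutes with flipping the sign, so the sign change depends only on [w] and [x]. *)
have phiE w x e : bij_fun (phi w) (x, e) =
    (w * x * w^-1, e (+) (bij_fun (phi w) (x, false)).2).
  have [p pS <-] := word_exists w.
  elim: p pS x e => [_|s p IHp /= /andP[sS pS]] x e.
    by rewrite big_nil multiplicative1 mul1g invg1 mulg1 addbF.
  rewrite big_cons !phiM phiS // IHp // [bij_fun _ (x, false)]IHp //=.
  rewrite /toggle /= invgM !mulgA.
  by rewrite -addbA.
(* With [w^-1], the reflections crossed are the conjugates of a letter by the prefix before it, so
   that [x * w] is the word with that letter deleted. *)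
exists (fun w x => (bij_fun (phi w^-1) (x, false)).2); split=> [s x sS|w w' x].
  by rewrite cox_inv // phiS.
rewrite invgM phiM [bij_fun (phi w^-1) _]phiE addFb invgK.
by rewrite [in LHS](phiE w'^-1).
Qed.

(** The parity [eta w s] depends on [w] alone. If it is odd, every word for [w] crosses [s], and
    multiplying by [s] deletes the letter at a crossing; if it is even, it is odd for [s * w]. *)
Lemma exchange_condition s w : s \in S ->
  (len (s * w) = (len w).+1) \/
  (len w = (len (s * w)).+1 /\
   forall p, all [in S] p -> wprod p = w ->
   exists p1 a p2, p = p1 ++ a :: p2 /\ s * w = wprod (p1 ++ p2)).
Proof.
move=> sS.
(* For s in S, eta w s holds exactly when len (s * w) < len w. *)
have [eta [etaS etaM]] := inversion_parity.
have eta_word p x : all [in S] p -> eta (wprod p) x ->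
    exists p1 a p2, p = p1 ++ a :: p2 /\ x * wprod p = wprod (p1 ++ p2).
  elim: p x => [|a p IHp] x /=.
    rewrite big_nil => _.
    have eta1 : eta 1 x = false.
      by have := etaM 1 1 x; rewrite invg1 mulg1 mul1g mulg1; case: (eta 1 x).
    by rewrite eta1.
  case/andP=> aS pS; rewrite big_cons etaM etaS //.
  have [-> _|/= xa] := eqVneq x a.
    by exists [::], a, p; rewrite mulgA cox_invol ?mul1g.
  case/(IHp _ pS) => p1 [c [p2 [-> def_p]]]; exists (a :: p1), c, p2; split=> //.
  rewrite big_cons -def_p.
  by rewrite !mulgA mulgV mul1g.
have len_s v : (len (s * v) <= (len v).+1)%N.
  apply: leq_trans (lenM_le _ _) _; rewrite -add1n leq_add2r.
  by have := @len_wprod [:: s]; rewrite big_seq1 /= sS => ->.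
have eta_lt v : eta v s -> (len (s * v) < len v)%N.
  have [p [pS <-] <-] := len_word v => /(eta_word _ _ pS) [p1 [a [p2 [def_p ->]]]].
  move: pS; rewrite def_p size_cat addnS -size_cat ltnS all_cat /= => /and3P[p1S _ p2S].
  by apply: len_wprod; rewrite all_cat p1S.
case ews: (eta w s); [right|left].
  split=> [|p pS pw]; last by subst w; apply: eta_word.
  apply/eqP; rewrite eqn_leq eta_lt // -{1}[w](cox_mulK _ sS) len_s //.
apply/eqP; rewrite eqn_leq len_s -{1}[w](cox_mulK _ sS) eta_lt //.
by rewrite etaM etaS // eqxx mulVg mul1g ews.
Qed.

Lemma len_descent s w : s \in S ->
  (len (s * w) = (len w).+1) \/ (len w = (len (s * w)).+1).
Proof. by move=> /(exchange_condition w) [|[]]; [left|right]. Qed.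

Lemma exchange s p : s \in S -> all [in S] p -> (len (s * wprod p) < len (wprod p))%N ->
  exists p1 a p2, p = p1 ++ a :: p2 /\ s * wprod p = wprod (p1 ++ p2).
Proof.
move=> sS pS lt; have [E|[_ exch]] := exchange_condition (wprod p) sS; last exact: exch.
by move: lt; rewrite E ltnNge leqnSn.
Qed.

Lemma len_gen s : s \in S -> len s = 1%N.
Proof. by move=> sS; have := len_descent 1 sS; rewrite mulg1 len1 => -[]. Qed.

Lemma cat_cons_split (T : Type) (r p p1 p2 : seq T) a : r ++ p = p1 ++ a :: p2 ->
  (exists r2, r = p1 ++ a :: r2 /\ p2 = r2 ++ p) \/
  (exists p0, p1 = r ++ p0 /\ p = p0 ++ a :: p2).
Proof.
elim: r p1 => [|x r IHr] [|y p1] /=.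
- by move=> ->; right; exists [::].
- by move=> ->; right; exists (y :: p1).
- by case=> -> <-; left; exists r.
case=> -> /IHr [[r2 [-> ->]]|[p0 [-> ->]]]; first by left; exists r2.
by right; exists p0.
Qed.

(** Exchange in a reduced word of [v] followed by [p]: a deletion inside the word of [v] would make
    [s * v] shorter than [v]. *)
Lemma exchangeM s v p : s \in S -> all [in S] p ->
  (len v < len (s * v))%N -> (len (s * (v * wprod p)) < len (v * wprod p))%N ->
  exists p1 a p2, p = p1 ++ a :: p2 /\ s * (v * wprod p) = v * wprod (p1 ++ p2).
Proof.
move=> sS pS lv; have [r [rS rv] rl] := len_word v.
have -> : v * wprod p = wprod (r ++ p) by rewrite wprod_cat rv.
move=> lt.
have [|p1 [a [p2 [E E']]]] := exchange sS _ lt; first by rewrite all_cat rS.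
case: (cat_cons_split E) => [[r2 [def_r def_p2]]|[p0 [def_p1 def_p]]]; last first.
  by exists p0, a, p2; rewrite E' def_p1 -catA wprod_cat rv.
have: (len (s * v) <= size (p1 ++ r2))%N.
  have -> : s * v = wprod (p1 ++ r2).
    by move: E'; rewrite def_p2 catA !wprod_cat mulgA rv => /mulIg.
  apply: len_wprod; move: rS; rewrite def_r !all_cat /=.
  by case/and3P=> ->.
move: rl lv; rewrite def_r !size_cat /=; lia.
Qed.

(** The only letter that [exchangeM] can delete from the word [[:: t]] is [t]. *)
Lemma len_lift s t v : s \in S -> t \in S ->
  (len v < len (s * v))%N -> (len (s * v * t) < len (v * t))%N -> s * v * t = v.
Proof.
move=> sS tS lv lt.
have := @exchangeM s v [:: t] sS; rewrite /= tS big_seq1 mulgA.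
case=> // p1 [a [p2 [+ ->]]]; case: p1 => [|x [|//]] //= [_ <-].
by rewrite big_nil mulg1.
Qed.

End Words.

(** * Reduced words *)

Section ReducedWords.
Local Open Scope group_scope.
Variables (W : groupType) (S : {pred W}).
Hypothesis cox : coxeter_system S.

Local Notation len := (cox_length S).
Local Notation wprod r := (\prod_(x <- r) x).

Definition reduced (p : seq W) := all [in S] p && (len (wprod p) == size p).

Lemma reducedP p : reduced p -> all [in S] p /\ len (wprod p) = size p.
Proof. by case/andP=> pS /eqP. Qed.

Lemma reduced_word w : exists2 p, reduced p & wprod p = w.
Proof.
have [p [pS pw] lp] := len_word cox w; exists p => //.
by rewrite /reduced pS pw lp eqxx.
Qed.

Lemma reduced_cat p q : reduced (p ++ q) -> reduced p /\ reduced q.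
Proof.
case/reducedP; rewrite all_cat => /andP[pS qS]; rewrite wprod_cat size_cat => lpq.
have := lenM_le cox (wprod p) (wprod q).
have := len_wprod cox pS; have := len_wprod cox qS.
rewrite /reduced pS qS lpq /= => leq lep le.
by split; apply/eqP; lia.
Qed.

Lemma reduced_behead s p : reduced (s :: p) -> reduced p.
Proof. by rewrite -cat1s => /reduced_cat[]. Qed.

Lemma reduced_rev p : reduced p -> reduced (rev p).
Proof.
case/reducedP=> pS lp; rewrite /reduced all_rev pS size_rev.
by rewrite (wprod_rev cox) // lenV // lp eqxx.
Qed.

Lemma reduced_cons s p : s \in S -> reduced p ->
  (len (wprod p) < len (s * wprod p))%N -> reduced (s :: p).
Proof.
move=> sS /reducedP[pS lp] lt; rewrite /reduced /= sS pS big_cons /=.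
by have := len_descent cox (wprod p) sS; rewrite lp => -[->|]; lia.
Qed.

Lemma reduced_consW s p : reduced (s :: p) -> (len (wprod p) < len (s * wprod p))%N.
Proof.
move=> rsp; have [_] := reducedP rsp; have [_ ->] := reducedP (reduced_behead rsp).
by rewrite big_cons => ->.
Qed.

Lemma cox_neq s w : s \in S -> s * w <> w.
Proof. by move=> sS E; have := len_descent cox w sS; rewrite E; lia. Qed.

(** * Parabolic subgroups and their cosets *)

Section Parabolic.
Variable J : {pred W}.
Hypothesis JS : {subset J <= S}.

Lemma all_JS p : all [in J] p -> all [in S] p.
Proof. by apply: sub_all. Qed.

(** One more letter either prolongs the reduced word or, by exchange, deletes one of its letters;
    both stay inside [J]. *)
Lemma parabolic_reduced p : all [in J] p ->
  exists q, [/\ all [in J] q, reduced q & wprod q = wprod p].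
Proof.
elim: p => [|r p IHp] /=.
  by exists [::]; split=> //; rewrite /reduced /= big_nil (len1 cox).
case/andP=> rJ /IHp [q [qJ rq def_p]]; rewrite big_cons -def_p.
have [qS lq] := reducedP rq.
have [E|[E exch]] := exchange_condition cox (wprod q) (JS rJ).
  exists (r :: q); rewrite /= rJ qJ big_cons; split=> //.
  by apply: reduced_cons; rewrite ?JS // E.
have [q1 [a [q2 [def_q E']]]] := exch q qS erefl.
move: qJ; rewrite def_q all_cat /= => /and3P[q1J _ q2J].
exists (q1 ++ q2); rewrite /reduced all_JS all_cat q1J // -E' -def_q; split=> //=.
apply/eqP; move: E lq; rewrite def_q !size_cat /=; lia.
Qed.

(** Additivity of lengths characterizes the shortest element of the coset of [b] under the subgroup
    generated by [J]. *)
Definition coset_minimal b :=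
  forall q, all [in J] q -> reduced q -> len (wprod q * b) = (size q + len b)%N.

(** [b] is taken of least length in the coset. If a letter [r] shortened [wprod q * b], exchange
    would delete a letter of [b] and produce a shorter element of the coset. *)
Lemma coset_decomposition w : exists p b,
  [/\ all [in J] p, reduced p, w = wprod p * b & coset_minimal b].
Proof.
pose P n := `[< exists p b, [/\ all [in J] p, w = wprod p * b & len b = n] >].
have exP : exists n, P n.
  by exists (len w); apply/asboolP; exists [::], w; rewrite big_nil mul1g.
case: (ex_minnP exP) => _ /asboolP[p0 [b [p0J def_w <-]]] nmin.
have [p [pJ rp def_p]] := parabolic_reduced p0J.
exists p, b; rewrite def_w def_p; split=> //.
have bmin q : all [in J] q -> (len b <= len (wprod q * b))%N.
  move=> qJ; apply: nmin; apply/asboolP; exists (p0 ++ rev q), (wprod q * b).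
  rewrite all_cat all_rev p0J qJ wprod_cat (wprod_rev cox) ?all_JS //.
  by split; rewrite // def_w mulgA mulgVK.
have [c [cS cb] lc] := len_word cox b.
elim=> [|r q IHq] /=; first by rewrite big_nil mul1g.
case/andP=> rJ qJ rrq; have rq := reduced_behead rrq.
rewrite big_cons -mulgA.
have [->|E] := len_descent cox (wprod q * b) (JS rJ); first by rewrite IHq.
have := @exchangeM _ _ cox r (wprod q) c (JS rJ) cS (reduced_consW rrq).
rewrite cb => -[|c1 [a [c2 [def_c E']]]]; first by rewrite E.
(* Conjugating [r] by [wprod q] gives an element that takes [b] to the product of [c1 ++ c2]. *)
have := bmin (rev q ++ r :: q).
rewrite all_cat all_rev qJ /= rJ wprod_cat (wprod_rev cox) ?all_JS // big_cons.
rewrite -!mulgA E' mulKg qJ => /(_ isT).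
have : (len (wprod (c1 ++ c2)) <= size (c1 ++ c2))%N.
  apply: len_wprod => //; move: cS; rewrite def_c !all_cat /=.
  by case/and3P=> ->.
by move: lc; rewrite def_c !size_cat /=; lia.
Qed.

(** In the decomposition of [w], the first letter of a nonempty [p] would shorten [w]. *)
Lemma coset_minimal_descent w :
  (forall r, r \in J -> (len w < len (r * w))%N) -> coset_minimal w.
Proof.
move=> wmin; have [p [b [pJ rp def_w bmin]]] := coset_decomposition w.
case: p pJ rp def_w => [|r p] /=; first by rewrite big_nil mul1g => _ _ ->.
case/andP=> rJ pJ rrp def_w; have := wmin r rJ.
have lw : len w = (size (r :: p) + len b)%N by rewrite def_w bmin //= rJ.
rewrite {2}def_w big_cons -mulgA (cox_mulK cox) ?JS // bmin ?(reduced_behead rrp) //.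
by rewrite lw /=; lia.
Qed.

End Parabolic.

(** * Alternating words and braid pairs *)

Section Alternating.

Definition letter (s t : W) k := if odd k then t else s.

(** Words grow on the left: the last letter is [s], and [letter s t k] is the one that prolongs the
    word of length k. *)
Fixpoint altword (s t : W) k :=
  if k is k'.+1 then letter s t k' :: altword s t k' else [::].

Lemma letterS s t k : letter s t k.+1 = letter t s k.
Proof. by rewrite /letter /=; case: odd. Qed.

Lemma mem_letter (P : {pred W}) s t k : s \in P -> t \in P -> letter s t k \in P.
Proof. by rewrite /letter; case: odd. Qed.

Lemma letter_pair s t k :
  (letter s t k = s /\ letter t s k = t) \/ (letter s t k = t /\ letter t s k = s).
Proof. by rewrite /letter; case: odd; [right|left]. Qed.

Lemma size_altword s t k : size (altword s t k) = k.
Proof. by elim: k => //= k ->. Qed.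

Lemma altword_rcons s t k : altword s t k.+1 = rcons (altword t s k) s.
Proof.
elim: k => [|k IHk] //; have -> : altword s t k.+2 = letter s t k.+1 :: altword s t k.+1 by [].
by rewrite IHk letterS.
Qed.

Lemma all_altword (P : {pred W}) s t k : s \in P -> t \in P -> all [in P] (altword s t k).
Proof. by move=> sP tP; elim: k => //= k ->; rewrite mem_letter. Qed.

Lemma wprod_altword s t k :
  wprod (altword s t k.+1) = letter s t k * wprod (altword s t k).
Proof. by rewrite /= big_cons. Qed.

Lemma wprod_altwordr s t k :
  wprod (altword s t k.+1) = wprod (altword t s k) * s.
Proof. by rewrite altword_rcons wprod_rcons. Qed.

(** Equal neighbours would cancel, so the letters alternate. *)
Lemma reduced_alternating s t p : reduced p -> all [in pred2 s t] p ->
  p = altword s t (size p) \/ p = altword t s (size p).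
Proof.
elim: p => [|x p IHp] rp /=; first by left.
case/andP=> xst pst.
have wlog_case a b : p = altword a b (size p) -> x \in pred2 a b ->
    x :: p = altword a b (size p).+1 \/ x :: p = altword b a (size p).+1.
  case: {IHp} p pst rp => [|y p] _ rp /=.
    by move=> _; rewrite !inE => /orP[]/eqP ->; [left|right].
  case=> def_y def_p xab; have xy : x <> y.
    move=> xy; move: rp => /reducedP[/and3P[xS _ pS]].
    rewrite -xy !big_cons (cox_mulK cox) //= => lp.
    by have := len_wprod cox pS; rewrite lp ltnNge leqnSn.
  left; congr cons; last by congr cons.
  move: xab xy; rewrite def_y letterS !inE.
  by case: (letter_pair a b (size p)) => -[-> ->] /orP[]/eqP ->.
have [e|e] := IHp (reduced_behead rp) pst; first exact: wlog_case.
by case: (wlog_case _ _ e); [move: xst; rewrite !inE orbC|right|left].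
Qed.

(** For [s] and [t] distinct and [m] positive, this says that [s * t] has order [m]; an infinite
    order admits no positive [m]. The value [m = 0] is allowed and gives an empty relation. *)
Definition braid_pair s t m :=
  [/\ s \in S, t \in S, reduced (altword s t m) &
      wprod (altword s t m) = wprod (altword t s m)].

Variables (s t : W) (m : nat).
Hypothesis st : braid_pair s t m.

Lemma braid_pairC : braid_pair t s m.
Proof.
have [sS tS /reducedP[_ l] E] := st; split=> //.
by rewrite /reduced all_altword // -E l !size_altword eqxx.
Qed.

Lemma braid_reduced n : (n <= m)%N -> reduced (altword s t n).
Proof.
move=> nm; have [_ _ + _] := st; rewrite -(subnK nm).
by elim: (m - n)%N => //= k IHk /reduced_behead.
Qed.

Lemma braid_len n : (n <= m)%N -> len (wprod (altword s t n)) = n.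
Proof. by case/braid_reduced/reducedP => _ ->; rewrite size_altword. Qed.

End Alternating.

(** If the products agreed, the letter prolonging one of them would cancel the first letter of the
    other, against [braid_len]. *)
Lemma braid_neq s t m n : braid_pair s t m -> (0 < n < m)%N ->
  wprod (altword s t n) <> wprod (altword t s n).
Proof.
case: n => // n st /andP[_ nm] E.
have := braid_len st nm; rewrite wprod_altword E wprod_altword letterS.
have [sS tS _ _] := st.
rewrite (cox_mulK cox); last exact: mem_letter.
by rewrite (braid_len (braid_pairC st)); lia.
Qed.

End ReducedWords.

(** * Twisted involutions *)

Section TwistedInvolutions.
Local Open Scope group_scope.
Variables (W : groupType) (S : {pred W}) (star : {multiplicative W -> W}).
Hypothesis cox : coxeter_system S.
Hypothesis starK : forall w, star (star w) = w.
Hypothesis starS : forall s, s \in S -> star s \in S.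

Local Notation len := (cox_length S).
Local Notation wprod r := (\prod_(x <- r) x).
Local Notation I := (twisted_involution star).

Lemma star_wprod p : star (wprod p) = wprod (map star p).
Proof.
elim: p => [|s p IHp]; first by rewrite !big_nil multiplicative1.
by rewrite /= !big_cons gmulfM IHp.
Qed.

Lemma all_star p : all [in S] p -> all [in S] (map star p).
Proof. by move=> pS; rewrite all_map; apply: sub_all pS => s; apply: starS. Qed.

Lemma len_star w : len (star w) = len w.
Proof.
suff le_len v : (len (star v) <= len v)%N.
  by apply/eqP; rewrite eqn_leq le_len -{1}[w]starK le_len.
have [p [pS <-] <-] := len_word cox v.
by rewrite star_wprod -(size_map star) (len_wprod cox) ?all_star.
Qed.

Lemma twistedP w : reflect (star w = w^-1) (w \in I).
Proof. by apply: (iffP eqP) => [E|->]; [rewrite -[LHS]invgK E|rewrite invgK]. Qed.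

Lemma twisted_conj x w : w \in I -> x * w * star x^-1 \in I.
Proof.
move=> /twistedP wI; apply/twistedP.
by rewrite !gmulfM starK wI !invgM multiplicativeV !invgK mulgA.
Qed.

Lemma twisted_conj_gen s w : s \in S -> w \in I -> s * w * star s \in I.
Proof. by move=> sS; rewrite -{2}[s](cox_inv cox) //; apply: twisted_conj. Qed.

Lemma twisted_mul s w : s \in S -> w \in I -> s * w = w * star s -> s * w \in I.
Proof.
move=> sS /twistedP wI E; apply/twistedP.
by rewrite {2}E invgM gmulfM wI (cox_inv cox (starS sS)).
Qed.

(** Apply the antiautomorphism sending x to [star x^-1], which fixes [b]. *)
Lemma twisted_swap b r r' : b \in I -> r \in S -> r' \in S ->
  r * b = b * star r' -> r' * b = b * star r.
Proof.
move=> /twistedP bI rS r'S /(congr1 (fun x => star x^-1)).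
rewrite !invgM !gmulfM !multiplicativeV starK bI invgK.
by rewrite (cox_inv cox (starS rS)) (cox_inv cox r'S).
Qed.

(** The same antiautomorphism preserves lengths and exchanges the two products. *)
Lemma twisted_len_right s w : s \in S -> w \in I -> len (w * star s) = len (s * w).
Proof.
move=> sS /twistedP wI; rewrite -len_star -lenV // gmulfM starK wI.
by rewrite invgM invgK (cox_inv cox sS).
Qed.

(** If [star s] did not lengthen [s * w], then [len_lift] would give [s * w * star s = w], hence
    equality of [s * w] and [w * star s]. *)
Lemma twisted_up s w : s \in S -> w \in I -> s * w <> w * star s ->
  (len w < len (s * w))%N -> len (s * w * star s) = (len w).+2.
Proof.
move=> sS wI ne lt; have lr := twisted_len_right sS wI.
have lift := @len_lift _ _ cox s (star s) w sS (starS sS) lt.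
have := len_descent cox (w * star s) sS.
have := len_descent cox w sS; rewrite -lr mulgA.
move=> [E|E]; last by move: lt; rewrite -lr; lia.
case=> [->|E']; first by rewrite E.
case: ne; rewrite -{2}lift; last by rewrite E'.
by rewrite -mulgA -gmulfM (cox_invol cox) // multiplicative1 mulg1.
Qed.

Lemma twisted_down s w : s \in S -> w \in I -> s * w <> w * star s ->
  (len (s * w) < len w)%N -> len w = (len (s * w * star s)).+2.
Proof.
move=> sS wI ne lt; have lr := twisted_len_right sS wI.
have [|E] := len_descent cox (s * w * star s) sS.
  rewrite mulgA (cox_mulK cox) // lr => E.
  have [E'|E'] := len_descent cox w sS; first by move: lt; rewrite E'; lia.
  by rewrite E' E.
have : s * (s * w) * star s = s * w.
  apply: (len_lift cox) => //; rewrite ?starS // ?(cox_mulK cox) //.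
  by rewrite E mulgA (cox_mulK cox).
by rewrite (cox_mulK cox) // => e; case: ne.
Qed.

Section Parabolic.
Variable J : {pred W}.
Hypothesis JS : {subset J <= S}.

(** [exchangeM] is applied to the word [map star p], and [star] pulls the shortened word back into
    [J]. *)
Lemma star_exchange r v p : r \in S -> all [in J] p -> (len v < len (r * v))%N ->
  (len (r * (v * star (wprod p))) < len (v * star (wprod p)))%N ->
  exists q, [/\ all [in J] q, (size q < size p)%N &
    r * (v * star (wprod p)) = v * star (wprod q)].
Proof.
move=> rS pJ lt; rewrite star_wprod => lt'.
have pS := all_star (all_JS JS pJ).
have [q1 [a [q2 [def_p ->]]]] := exchangeM cox rS pS lt lt'.
have sK : cancel (map star) (map star) by apply: mapK.
exists (map star q1 ++ map star q2); split.
- move: pJ; rewrite -[p]sK def_p map_cat !all_cat /=.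
  by case/and3P=> ->.
- by rewrite -(size_map star p) def_p !size_cat !size_map /= addnS.
by rewrite star_wprod map_cat !sK.
Qed.

(** The letter [r] shortens [b * star (wprod q)], so the exchange takes place in [q] and moves [r]
    across [b]; comparing lengths on both sides of [b] leaves a single letter. *)
Lemma minimal_coset_descent b r p q : b \in I -> coset_minimal S J b ->
  r \in J -> all [in J] p -> all [in J] q -> reduced S (r :: p) ->
  wprod (r :: p) * b = b * star (wprod q) ->
  exists2 r', r' \in J & r * b = b * star r'.
Proof.
move=> bI bmin rJ pJ qJ rrp E.
have lb : (len b < len (r * b))%N.
  have := bmin [:: r]; rewrite /= rJ big_seq1 => ->; rewrite ?add1n //.
  by rewrite /reduced /= JS // big_seq1 (len_gen cox) ?JS.
have Er : r * (b * star (wprod q)) = wprod p * b.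
  by rewrite -E big_cons -mulgA (cox_mulK cox) ?JS.
have lt : (len (r * (b * star (wprod q))) < len (b * star (wprod q)))%N.
  rewrite Er -E !bmin //= ?rJ //; exact: reduced_behead rrp.
have [q' [q'J _ E']] := star_exchange (JS rJ) qJ lb lt.
have [|c [cJ rc def_c]] := parabolic_reduced cox JS (p := q' ++ rev q).
  by rewrite all_cat all_rev q'J.
have rb : r * b = b * star (wprod c).
  rewrite def_c wprod_cat (wprod_rev cox) ?(all_JS JS) // gmulfM multiplicativeV.
  by rewrite mulgA -E' !mulgA mulgK.
(* Lengths also add on the right of [b], by the antiautomorphism sending x to [star x^-1]. *)
have lc : len (b * star (wprod c)) = (size c + len b)%N.
  have /twistedP bI' := bI.
  rewrite -(lenV cox) -len_star invgM gmulfM -bI' starK -multiplicativeV starK.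
  by rewrite -(wprod_rev cox) ?(all_JS JS) // bmin ?all_rev ?reduced_rev // size_rev.
have : size c = 1%N.
  have := len_descent cox b (JS rJ).
  by rewrite rb lc; move: lb; rewrite rb lc; lia.
case: c cJ {lc def_c rc} rb => [|r' [|//]] //=; rewrite andbT big_seq1 => r'J rb _.
by exists r'.
Qed.

End Parabolic.

End TwistedInvolutions.

(** * Braid defects *)

Section SecondOrderRecurrence.
Local Open Scope ring_scope.
Variables (R : comNzRingType) (M : lmodType R) (q : R) (Z : M -> M) (X : nat -> M).
Hypothesis ZZ : forall c x, Z (c *: x) = c *: Z x.
Hypothesis X_rec : forall k, X k.+2 = Z (X k.+1) - q *: X k.
Hypothesis X0 : X 0%N = 0.

(** Inductively, the term of index b + j is c q^j times the term of index a + 1 - j; at j = a + 1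
    this reaches [X 0]. *)
Lemma recurrence_reflection c a b :
  X b = c *: X a.+1 -> X b.+1 = (c * q) *: X a -> X (a.+1 + b)%N = 0.
Proof.
elim: a b c => [|a IHa] b c Xb Xb1; first by rewrite Xb1 X0 scaler0.
rewrite -[(a.+2 + b)%N]/(a.+1 + b).+1 -addnS; apply: (IHa _ (c * q)) => //.
by rewrite X_rec Xb1 ZZ Xb X_rec; lmodule R.
Qed.

(** This lemma and the next two place the centre of the reflection at n, n + 1/2 and n + 1, with
    initial factors -1, c and q. *)
Lemma recurrence_reflection0 n : X n = 0 -> X n.*2 = 0.
Proof.
case: n => [|n] Xn; first by rewrite X0.
rewrite -addnn; apply: (@recurrence_reflection (-1)); rewrite ?Xn ?scaler0 //.
by rewrite X_rec Xn -[in Z 0](scale0r 0) ZZ scale0r sub0r mulN1r scaleNr.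
Qed.

Lemma recurrence_reflection1 n c : c ^+ 2 = q -> X n.+1 = c *: X n -> X n.*2.+1 = 0.
Proof.
case: n => [|n] cq Xn; first by rewrite Xn X0 scaler0.
rewrite -addnn -addnS; apply: (@recurrence_reflection c) => //.
rewrite X_rec Xn ZZ.
have -> : Z (X n.+1) = X n.+2 + q *: X n by rewrite X_rec subrK.
by rewrite Xn scalerDr !scalerA -cq -expr2 addrC addKr.
Qed.

Lemma recurrence_reflection2 n : X n.+2 = q *: X n -> X n.*2.+2 = 0.
Proof.
case: n => [|n] Xn; first by rewrite Xn X0 scaler0.
rewrite -addnn -!addnS; apply: (@recurrence_reflection q) => //.
rewrite X_rec Xn ZZ.
have -> : Z (X n.+1) = X n.+2 + q *: X n by rewrite X_rec subrK.
by rewrite scalerDr scalerA addrC addKr.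
Qed.

End SecondOrderRecurrence.

(** * Operators acting through words *)

Section WordAction.
Local Open Scope ring_scope.
Variables (R : comNzRingType) (W : groupType) (S : {pred W}).
Variables (M : lmodType R) (q : R) (rho : W -> {linear M -> M}).
Hypothesis rho_quad : forall s v, s \in S ->
  rho s (rho s v) = (q - 1) *: rho s v + q *: v.

Definition word_act (p : seq W) (v : M) := foldr (fun s => rho s) v p.

Lemma word_act_cat p r v : word_act (p ++ r) v = word_act p (word_act r v).
Proof. exact: foldr_cat. Qed.

Lemma word_act_rcons p s v : word_act (rcons p s) v = word_act p (rho s v).
Proof. by rewrite -cats1 word_act_cat. Qed.

Lemma word_act_is_linear p : linear (word_act p).
Proof. by elim: p => [|s p IHp] c x y //=; rewrite IHp linearP. Qed.

HB.instance Definition _ p :=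
  GRing.isLinear.Build R M M _ (word_act p) (word_act_is_linear p).

Variables s t : W.
Hypotheses (sS : s \in S) (tS : t \in S).

Definition braid_defect k v := word_act (altword s t k) v - word_act (altword t s k) v.

Lemma word_act_altword x y k v :
  word_act (altword x y k.+1) v = rho (letter x y k) (word_act (altword x y k) v).
Proof. by []. Qed.

Lemma word_act_altwordr x y k v :
  word_act (altword x y k.+1) v = word_act (altword y x k) (rho x v).
Proof. by rewrite altword_rcons word_act_rcons. Qed.

Lemma rho_letter_sum x y k v :
  rho (letter x y k) v + rho (letter y x k) v = rho x v + rho y v.
Proof. by case: (letter_pair x y k) => -[-> ->] //; rewrite addrC. Qed.

(** One of the two operators prolongs the alternating word; the other repeats its first letter, and
    the quadratic relation removes the square. *)
Lemma word_act_rec x y k v : x \in S -> y \in S ->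
  let w k := word_act (altword x y k) v in
  rho x (w k.+1) + rho y (w k.+1) = w k.+2 + ((q - 1) *: w k.+1 + q *: w k).
Proof.
move=> xS yS /=; rewrite -(rho_letter_sum _ _ k.+1); congr (_ + _).
by rewrite letterS rho_quad // mem_letter.
Qed.

Lemma braid_defect_rec v k :
  braid_defect k.+2 v = (rho s (braid_defect k.+1 v) + rho t (braid_defect k.+1 v)
    - (q - 1) *: braid_defect k.+1 v) - q *: braid_defect k v.
Proof.
have Es := word_act_rec k v sS tS; have Et := word_act_rec k v tS sS.
rewrite /= in Es Et; rewrite /braid_defect !linearB /=.
move: Es Et => /(canRL (addrK _)) -> /(canRL (addrK _)) ->.
lmodule R.
Qed.

(** One product now ends in a square of [rho x]; the other has become longer by one letter and,
    after the hypothesis is used, begins with a square. The quadratic relation reduces both to the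
    same terms. *)
Lemma word_act_braid_stable x y k v : x \in S -> y \in S ->
  word_act (altword x y k) v = word_act (altword y x k) v ->
  word_act (altword x y k) (rho x v) = word_act (altword y x k) (rho x v).
Proof.
move=> xS yS; case: k => [|k] E //.
rewrite word_act_altwordr rho_quad // linearD !linearZ /=.
rewrite -[RHS]/(word_act (altword y x k.+1) (rho x v)).
rewrite -(word_act_altwordr x y k) -(word_act_altwordr x y k.+1).
by rewrite (word_act_altword x y k.+1) E letterS rho_quad ?mem_letter.
Qed.

Lemma braid_defect_stable r k v : r \in pred2 s t ->
  braid_defect k v = 0 -> braid_defect k (rho r v) = 0.
Proof.
move=> rst /eqP; rewrite subr_eq0 => /eqP E; apply/eqP; rewrite subr_eq0; apply/eqP.
move: rst; rewrite inE => /orP[]/eqP ->; first exact: word_act_braid_stable.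
by symmetry; apply: word_act_braid_stable.
Qed.

End WordAction.

(** * Braid relations at twisted involutions *)

Section BraidRelation.
Local Open Scope ring_scope.
Variables (W : groupType) (S : {pred W}) (star : {multiplicative W -> W}).
Hypothesis cox : coxeter_system S.
Hypothesis starK : forall w, star (star w) = w.
Hypothesis starS : forall s, s \in S -> star s \in S.

Variables (R : comNzRingType) (M : lmodType R) (u : R).
Variables (rho : W -> {linear M -> M}) (a : W -> M).

Local Notation len := (cox_length S).
Local Notation wprod r := (\prod_(x <- r) x)%g.
Local Notation I := (twisted_involution star).

Hypothesis rho_quad : forall s v, s \in S ->
  rho s (rho s v) = (u ^+ 2 - 1) *: rho s v + u ^+ 2 *: v.
Hypothesis rho_comm : forall s w, s \in S -> w \in I -> (s * w = w * star s)%g ->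
  (len w < len (s * w)%g)%N -> rho s (a w) = u *: a w + (u + 1) *: a (s * w)%g.
Hypothesis rho_noncomm : forall s w, s \in S -> w \in I -> (s * w <> w * star s)%g ->
  (len w < len (s * w)%g)%N -> rho s (a w) = a (s * w * star s)%g.

Section Coset.
Variables (J : {pred W}) (b : W).
Hypotheses (JS : {subset J <= S}) (bI : b \in I) (bmin : coset_minimal S J b).

Lemma minimal_altword x y m n : braid_pair S x y m -> x \in J -> y \in J ->
  (n <= m)%N -> len (wprod (altword x y n) * b)%g = (n + len b)%N.
Proof.
move=> xy xJ yJ nm; rewrite bmin ?size_altword ?all_altword //.
exact: (braid_reduced cox xy nm).
Qed.

(** One climbing step: since [star r] crosses [b] and becomes [y], [r * z] and [z * star r] are the
    two alternating products of length n + 1, times [b]. They differ below [m], where (iii) applies,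
    and agree at [m], where (i) applies. *)
Lemma rho_altword x y m n : braid_pair S x y m -> x \in J -> y \in J -> (n < m)%N ->
  (wprod (altword x y n) * b)%g \in I -> (b * star (letter x y n) = y * b)%g ->
  ((n.+1 < m)%N -> (wprod (altword y x n.+2) * b)%g \in I /\
     rho (letter x y n) (a (wprod (altword x y n) * b)%g) =
       a (wprod (altword y x n.+2) * b)%g) /\
  (n.+1 = m -> rho (letter x y n) (a (wprod (altword x y n) * b)%g) =
     u *: a (wprod (altword x y n) * b)%g + (u + 1) *: a (wprod (altword x y m) * b)%g).
Proof.
move=> xy xJ yJ nm zI br; set r := letter x y n; set z := (wprod (altword x y n) * b)%g.
have rS : r \in S by rewrite mem_letter ?JS.
have rz : (r * z = wprod (altword x y n.+1) * b)%g by rewrite wprod_altword mulgA.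
have zr : (z * star r = wprod (altword y x n.+1) * b)%g.
  by rewrite -mulgA br mulgA -wprod_altwordr.
have lz : (len z < len (r * z)%g)%N.
  by rewrite rz !(minimal_altword xy) // ltnW.
split=> [n1m|n1m].
  have ne : (r * z <> z * star r)%g.
    by rewrite rz zr => /mulIg; apply: (braid_neq cox xy).
  have E : (r * z * star r = wprod (altword y x n.+2) * b)%g.
    by rewrite wprod_altword !letterS -/r -mulgA zr mulgA.
  by rewrite -E rho_noncomm //; split=> //; apply: (twisted_conj_gen cox).
rewrite rho_comm // rz -?n1m // zr.
by case: xy => _ _ _; rewrite n1m => ->.
Qed.

End Coset.

Section BraidAtMinimal.
Variables (s t : W) (m : nat) (b : W).
Hypotheses (st : braid_pair S s t m) (bI : b \in I).
Hypothesis bmin : coset_minimal S (pred2 s t) b.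

Let ts : braid_pair S t s m := braid_pairC st.
Let sS : s \in S. Proof. by case: st. Qed.
Let tS : t \in S. Proof. by case: st. Qed.
Let sJ : s \in pred2 s t. Proof. by rewrite !inE eqxx. Qed.
Let tJ : t \in pred2 s t. Proof. by rewrite !inE eqxx orbT. Qed.
Let JS : {subset pred2 s t <= S}.
Proof. by move=> r; rewrite inE => /orP[]/eqP ->. Qed.

Local Notation act := (word_act rho).
Local Notation D k := (braid_defect rho s t k (a b)).
Let Z (x : M) := rho s x + rho t x - (u ^+ 2 - 1) *: x.

Let ZZ c x : Z (c *: x) = c *: Z x.
Proof. by rewrite /Z !linearZ /=; lmodule R. Qed.

Let D0 : D 0 = 0. Proof. exact: subrr. Qed.

Let D_rec k : D k.+2 = Z (D k.+1) - u ^+ 2 *: D k.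
Proof. exact: (braid_defect_rec rho_quad sS tS). Qed.

Let letter_pair_st k : braid_pair S (letter s t k) (letter t s k) m.
Proof. by case: (letter_pair s t k) => -[-> ->]. Qed.

Let letterJ x y k : x \in pred2 s t -> y \in pred2 s t -> letter x y k \in pred2 s t.
Proof. exact: mem_letter. Qed.

(* The shape of the orbit of b depends on the group of the z in <s, t> with
   z b = b z'^* for some z' in <s, t>.  It is either all of <s, t>, acting on b with
   or without exchanging s and t, or it is {1, s}, {1, t} or trivial. *)
Lemma chain_swap x y k : braid_pair S x y m -> x \in pred2 s t -> y \in pred2 s t ->
  (x * b = b * star y)%g -> (y * b = b * star x)%g -> (k.*2 <= m)%N ->
  let z := (wprod (altword (letter x y k) (letter y x k) k.*2) * b)%g in
  z \in I /\ act (altword x y k) (a b) = a z.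
Proof.
move=> xy xJ yJ xb yb; elim: k => [|k IHk]; first by rewrite /= big_nil mul1g.
rewrite doubleS => km z; rewrite {}/z; have [|zI E] := IHk; first by clear -km; lia.
rewrite !letterS; move: zI E; set p := letter x y k; set p' := letter y x k => zI E.
have [pp' p'p] : braid_pair S p p' m /\ (p' * b = b * star p)%g.
  rewrite /p /p'; case: (letter_pair x y k) => -[-> ->] //; split=> //.
  exact: (braid_pairC xy).
have pE : letter p p' k.*2 = p by rewrite /letter odd_double.
have [|||||step _] := @rho_altword _ _ JS bmin p p' m k.*2 pp'; rewrite ?letterJ ?pE //.
  by clear -km; lia.
case: step => [|z'I E']; first by clear -km; lia.
by rewrite pE in E'; rewrite word_act_altword ?letterS E.
Qed.

(** Each operator climbs two lengths. For m = 2n both chains meet at the top, so D n = 0; for m = 2n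
    + 1 they stop one below the top, where (i) adds the same top term to both and D (n + 1) = u D
    n. *)
Lemma braid_defect_swap :
  (s * b = b * star t)%g -> (t * b = b * star s)%g -> D m = 0.
Proof.
move=> sb tb.
have cs k := @chain_swap s t k st sJ tJ sb tb.
have ct k := @chain_swap t s k ts tJ sJ tb sb.
have [n [m_even|m_odd]] : exists n, m = n.*2 \/ m = n.*2.+1.
- by exists m./2; have := odd_double_half m; case: odd => /= E; [right|left].
- rewrite m_even; apply: (recurrence_reflection0 ZZ D_rec D0).
  have [|_ Es] := cs n; first by clear -m_even; lia.
  have [|_ Et] := ct n; first by clear -m_even; lia.
  rewrite /braid_defect Es Et -m_even.
  by have [_ _ _ ->] := letter_pair_st n; rewrite subrr.
rewrite m_odd; apply: (recurrence_reflection1 ZZ D_rec D0 (c := u)) => //.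
have [|zsI Es] := cs n; first by clear -m_odd; lia.
have [|ztI Et] := ct n; first by clear -m_odd; lia.
have := letter_pair_st n; rewrite /braid_defect.
rewrite !word_act_altword Es Et.
move: zsI ztI; set p := letter s t n; set p' := letter t s n => zsI ztI pp'.
have [b1 b2] : (p' * b = b * star p)%g /\ (p * b = b * star p')%g.
  by rewrite /p /p'; case: (letter_pair s t n) => -[-> ->].
have pE x y : letter x y n.*2 = x by rewrite /letter odd_double.
have nm : (n.*2 < m)%N by clear -m_odd; lia.
have [|||||_ Fs] := @rho_altword _ _ JS bmin p p' m n.*2 pp'; rewrite ?letterJ ?pE //.
have [|||||_ Ft] := @rho_altword _ _ JS bmin p' p m n.*2 (braid_pairC pp'); rewrite ?letterJ ?pE //.
have [_ _ _ EE] := pp'.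
by rewrite !pE in Fs Ft; rewrite Fs // Ft // EE; lmodule R.
Qed.

(** The chain starts at [x * b], above the first step by (i); all later steps climb by two. *)
Lemma chain_comm x y k : braid_pair S x y m -> x \in pred2 s t -> y \in pred2 s t ->
  (x * b = b * star x)%g -> (y * b = b * star y)%g -> (k.*2 < m)%N ->
  let z := (wprod (altword (letter x y k) (letter y x k) k.*2.+1) * b)%g in
  z \in I /\ act (altword y x k) (a (x * b)%g) = a z.
Proof.
move=> xy xJ yJ xb yb; elim: k => [|k IHk].
  by rewrite /= big_seq1; split=> //; apply: (twisted_mul cox); rewrite ?JS.
rewrite doubleS => km z; rewrite {}/z; have [|zI E] := IHk; first by clear -km; lia.
rewrite !letterS; move: zI E; set p := letter x y k; set p' := letter y x k => zI E.
have [pp' p'p] : braid_pair S p p' m /\ (p' * b = b * star p')%g.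
  rewrite /p /p'; case: (letter_pair x y k) => -[-> ->] //; split=> //.
  exact: (braid_pairC xy).
have pE : letter p p' k.*2.+1 = p' by rewrite /letter /= odd_double.
have [|||||step _] := @rho_altword _ _ JS bmin p p' m k.*2.+1 pp'; rewrite ?letterJ ?pE //.
  by clear -km; lia.
case: step => [|z'I E']; first by clear -km; lia.
by rewrite pE in E'; rewrite word_act_altword ?letterS E.
Qed.

Lemma rho_comm_minimal x : x \in pred2 s t -> (x * b = b * star x)%g ->
  rho x (a b) = u *: a b + (u + 1) *: a (x * b)%g.
Proof.
move=> xJ xb; apply: rho_comm; rewrite ?JS //.
have := bmin (q := [:: x]); rewrite /= xJ big_seq1 => -> //.
by rewrite /reduced /= JS // big_seq1 (len_gen cox) ?JS.
Qed.

(** Splitting off the first step by (i) expresses D through the difference E of the two upper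
    chains. For m = 2n + 1 these meet, E n = 0 and D (n + 1) = - u D n; for m = 2n + 2 they stop one
    below the top and E (n + 1) = u E n. *)
Lemma braid_defect_comm :
  (s * b = b * star s)%g -> (t * b = b * star t)%g -> D m = 0.
Proof.
move=> sb tb.
have cs k := @chain_comm s t k st sJ tJ sb tb.
have ct k := @chain_comm t s k ts tJ sJ tb sb.
pose E k := act (altword t s k) (a (s * b)%g) - act (altword s t k) (a (t * b)%g).
have DE k : D k.+1 = (u + 1) *: E k - u *: D k.
  rewrite /braid_defect !word_act_altwordr !rho_comm_minimal // !linearD !linearZ /=.
  by rewrite /E; lmodule R.
have [n [->|[m_odd|m_even]]] : exists n, m = 0%N \/ m = n.*2.+1 \/ m = n.*2.+2.
- exists m.-1./2; have := odd_double_half m.-1.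
  by case: (m) => [|m'] /=; [left|case: odd => /= e; right; [right|left]; lia].
- exact: D0.
- have [|_ Es] := cs n; first by clear -m_odd; lia.
  have [|_ Et] := ct n; first by clear -m_odd; lia.
  rewrite m_odd; apply: (recurrence_reflection1 ZZ D_rec D0 (c := - u)).
    by rewrite sqrrN.
  rewrite DE /E Es Et -m_odd.
  have [_ _ _ ->] := letter_pair_st n; rewrite subrr; lmodule R.
have [|zsI Es] := cs n; first by clear -m_even; lia.
have [|ztI Et] := ct n; first by clear -m_even; lia.
rewrite m_even; apply: (recurrence_reflection2 ZZ D_rec D0).
have EE : E n.+1 = u *: E n.
  have := letter_pair_st n; rewrite /E !word_act_altword Es Et.
  move: zsI ztI; set p := letter s t n; set p' := letter t s n => zsI ztI pp'.
  have [b1 b2] : (p' * b = b * star p')%g /\ (p * b = b * star p)%g.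
    by rewrite /p /p'; case: (letter_pair s t n) => -[-> ->].
  have pE x y : letter x y n.*2.+1 = y by rewrite /letter /= odd_double.
  have nm : (n.*2.+1 < m)%N by clear -m_even; lia.
  have [|||||_ Fs] := @rho_altword _ _ JS bmin p p' m n.*2.+1 pp';
    rewrite ?letterJ ?pE //.
  have [|||||_ Ft] := @rho_altword _ _ JS bmin p' p m n.*2.+1 (braid_pairC pp');
    rewrite ?letterJ ?pE //.
  have [_ _ _ EE] := pp'.
  by rewrite !pE in Fs Ft; rewrite Fs // Ft // EE; lmodule R.
(* Eliminating [E] between [DE] at n and at n + 1 gives D (n + 2) = u^2 D n. *)
rewrite DE EE.
have -> : (u + 1) *: (u *: E n) = u *: (D n.+1 + u *: D n).
  by rewrite DE; lmodule R.
by lmodule R.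
Qed.

(** If [r] shortened [w], [star_exchange] would delete a letter of [q] and put [r * w] in the coset
    excluded by the last hypothesis. Equality of [r * w] and [w * star r] would do so too, hence
    (iii) applies. *)
Lemma rho_conj r p q x (w := (wprod p * b * star x^-1)%g) :
  r \in pred2 s t -> all [in pred2 s t] p -> reduced S (r :: p) ->
  all [in pred2 s t] q -> wprod q = (x^-1)%g -> w \in I ->
  (forall q', all [in pred2 s t] q' -> (r * w <> wprod p * b * star (wprod q'))%g) ->
  rho r (a w) = a (r * w * star r)%g.
Proof.
move=> rJ pJ rp qJ qx wI nw; apply: rho_noncomm; rewrite ?JS //.
  move=> E; apply: (nw (q ++ [:: r])); first by rewrite all_cat qJ /= rJ.
  by rewrite E wprod_cat big_seq1 gmulfM qx mulgA.
have [->|E] := len_descent cox w (JS rJ); first by [].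
have rp' := reduced_behead cox rp.
have [||||q' [q'J _ E']] := @star_exchange _ _ star cox starK starS _ JS r (wprod p * b)%g q.
- by rewrite JS.
- exact: qJ.
- rewrite mulgA -(big_cons _ _ r p xpredT idfun) !bmin //= ?rJ //.
- by rewrite qx -/w E.
- by case: (nw q' q'J); rewrite -E' qx.
Qed.

(** Iterating [rho_conj], the whole product acts by twisted conjugation. It is used with [p] empty
    or equal to [[:: s]]. *)
Lemma chain_conj x y p n : x \in pred2 s t -> y \in pred2 s t -> all [in pred2 s t] p ->
  (wprod p * b)%g \in I ->
  (forall k, (k < n)%N -> reduced S (altword x y k.+1 ++ p) /\
    forall z q, all [in pred2 s t] q -> z = (wprod (altword x y k) * wprod p)%g ->
    (letter x y k * (z * b * star (wprod (altword x y k))^-1) <>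
       z * b * star (wprod q))%g) ->
  act (altword x y n) (a (wprod p * b)%g) =
    a (wprod (altword x y n) * (wprod p * b) * star (wprod (altword x y n))^-1)%g.
Proof.
move=> xJ yJ pJ cI; elim: n => [|n IHn] step.
  by rewrite /= big_nil invg1 multiplicative1 mulg1 mul1g.
have [rn nw] := step n (ltnSn n).
rewrite word_act_altword IHn => [|k kn]; last by apply: step; rewrite ltnW.
set r := letter x y n in nw *; set z := wprod (altword x y n).
have rJ : r \in pred2 s t by apply: letterJ.
have aJ : all [in pred2 s t] (altword x y n) by apply: all_altword.
rewrite mulgA -wprod_cat.
rewrite (@rho_conj r (altword x y n ++ p) (rev (altword x y n)) z) //.
- by rewrite wprod_altword -/r -/z invgM gmulfM wprod_cat !mulgA (cox_inv cox (JS rJ)).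
- by rewrite all_cat aJ.
- by rewrite all_rev.
- by rewrite (wprod_rev cox) ?(all_JS JS).
- by rewrite wprod_cat -[(_ * _ * b)%g]mulgA; apply: (twisted_conj starK).
- by move=> q' q'J; apply: nw; rewrite ?wprod_cat.
Qed.

(** Carries a coincidence of cosets back to [b]: a conjugate of [r] falls into the group of those z
    in <s, t> that cross [b], which is small in the two cases below. *)
Lemma double_coset_conj p q r k :
  all [in pred2 s t] p -> all [in pred2 s t] q -> r \in pred2 s t ->
  all [in pred2 s t] k ->
  (r * (wprod p * b * star (wprod k)^-1) = wprod p * b * star (wprod q))%g ->
  exists p' q', [/\ all [in pred2 s t] p', all [in pred2 s t] q',
    (wprod p' * b = b * star (wprod q'))%g & wprod p' = ((wprod p)^-1 * r * wprod p)%g].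
Proof.
move=> pJ qJ rJ kJ E.
exists (rev p ++ r :: p), (q ++ k).
rewrite !all_cat all_rev pJ /= rJ qJ kJ pJ !wprod_cat big_cons (wprod_rev cox) ?(all_JS JS) //.
split; rewrite ?mulgA //.
have {}E := congr1 (fun x => (wprod p)^-1 * x * star (wprod k))%g E.
rewrite gmulfM; move: E; rewrite !mulgA mulVg mul1g => <-.
by rewrite multiplicativeV mulgVK.
Qed.

(** Only 1 crosses [b], so every step is a twisted conjugation, and both products conjugate by the
    same element of length [m]. *)
Lemma braid_defect_free :
  (forall r r', r \in pred2 s t -> r' \in pred2 s t -> (r * b <> b * star r')%g) ->
  D m = 0.
Proof.
move=> free.
have triv p q : all [in pred2 s t] p -> all [in pred2 s t] q ->
    (wprod p * b = b * star (wprod q))%g -> wprod p = 1%g.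
  move=> pJ qJ; have [[|r p'] [p'J rp' <-]] := parabolic_reduced cox JS pJ => E.
    by rewrite big_nil.
  case/andP: p'J => rJ p'J.
  have [r' r'J] := minimal_coset_descent cox starK starS JS bI bmin rJ p'J qJ rp' E.
  by move/free; case.
have chain x y : braid_pair S x y m -> x \in pred2 s t -> y \in pred2 s t ->
    act (altword x y m) (a b) =
    a (wprod (altword x y m) * b * star (wprod (altword x y m))^-1)%g.
  move=> xy xJ yJ; have := @chain_conj x y [::] m xJ yJ isT.
  rewrite !big_nil !mul1g => -> // k km; split.
    by rewrite cats0; apply: (braid_reduced cox xy).
  move=> z q qJ def_z E; set r := letter x y k in E.
  have rJ : r \in pred2 s t by apply: letterJ.
  have kJ : all [in pred2 s t] (altword x y k) by apply: all_altword.
  rewrite mulg1 in def_z; rewrite def_z in E.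
  have [p' [q' [p'J q'J /(triv _ _ p'J q'J) -> E']]] := double_coset_conj kJ qJ rJ kJ E.
  apply: (@cox_neq _ _ cox r (wprod (altword x y k))); first exact: JS.
  by apply: (@mulgI _ (wprod (altword x y k))^-1%g); rewrite mulVg mulgA -E'.
rewrite /braid_defect !chain //.
by have [_ _ _ ->] := st; rewrite subrr.
Qed.

(** Only 1 and [s] cross [b]. With x the product of [altword t s m.-1], one side applies (i) at [b]
    and then conjugates by x; the other conjugates by x and then applies (i), which fits because
    [r * x = x * s]. *)
Lemma braid_defect_half : (s * b = b * star s)%g ->
  (forall r, r \in pred2 s t -> (t * b <> b * star r)%g) -> D m = 0.
Proof.
move=> sb nt.
have sS' := cox_inv cox sS.
have stab p q : all [in pred2 s t] p -> all [in pred2 s t] q ->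
    (wprod p * b = b * star (wprod q))%g -> wprod p = 1%g \/ wprod p = s.
  move=> pJ qJ; have [[|r p'] [p'J rp' <-]] := parabolic_reduced cox JS pJ => E.
    by rewrite big_nil; left.
  case/andP: p'J => rJ p'J; right.
  have descs r0 p0 q0 : r0 \in pred2 s t -> all [in pred2 s t] p0 -> all [in pred2 s t] q0 ->
      reduced S (r0 :: p0) -> (wprod (r0 :: p0) * b = b * star (wprod q0))%g -> r0 = s.
    move=> r0J p0J q0J rp0 E0.
    have [r' r'J] := minimal_coset_descent cox starK starS JS bI bmin r0J p0J q0J rp0 E0.
    by case/orP: r0J => /eqP -> // /nt; case.
  have rs := descs _ _ _ rJ p'J qJ rp' E; subst r.
  case: p' rp' p'J E => [|r p'] rp' p'J E; first by rewrite big_seq1.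
  case/andP: (p'J) => rJ' p''J.
  (* Cancelling the leading [s] leaves an element that still crosses [b], so the second letter would
     be [s] as well and the word would not be reduced. *)
  have rs : r = s.
    apply: (descs r p' (s :: q)) => //=; rewrite ?sJ //; first exact: reduced_behead rp'.
    rewrite [X in star X]big_cons gmulfM mulgA -sb -mulgA -E.
    by rewrite [in RHS]big_cons -[in RHS]mulgA (cox_mulK cox).
  move: rp'; rewrite rs => rp'; have := reduced_consW cox rp'.
  have [_ ->] := reducedP (reduced_behead cox rp').
  rewrite big_cons (cox_mulK cox) // => lt.
  have := len_wprod cox (all_JS JS p''J).
  by move: lt; clear; rewrite /=; lia.
have sbI : (s * b)%g \in I by apply: (twisted_mul cox).
have [m0|m0] := posnP m; first by rewrite m0 D0.
have chain (p : seq W) : p = [::] \/ p = [:: s] ->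
    act (altword t s m.-1) (a (wprod p * b)%g) =
    a (wprod (altword t s m.-1) * (wprod p * b) * star (wprod (altword t s m.-1))^-1)%g.
  move=> ps; have pJ : all [in pred2 s t] p by case: ps => ->; rewrite //= sJ.
  have spC : (wprod p * s = s * wprod p)%g.
    by case: ps => ->; rewrite ?big_nil ?mulg1 ?mul1g ?big_seq1.
  apply: chain_conj => // [|k km]; first by case: ps => ->; rewrite ?big_nil ?mul1g ?big_seq1.
  split.
    case: ps => ->; first by rewrite cats0; apply: (braid_reduced cox ts); clear -km; lia.
    by rewrite cats1 -altword_rcons; apply: (braid_reduced cox st); clear -km; lia.
  move=> z q qJ def_z E; set r := letter t s k in E.
  have rJ : r \in pred2 s t by apply: letterJ.
  have kJ : all [in pred2 s t] (altword t s k) by apply: all_altword.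
  have aJ : all [in pred2 s t] (altword t s k ++ p) by rewrite all_cat kJ.
  rewrite -wprod_cat in def_z; rewrite def_z in E.
  have [p' [q' [p'J q'J /(stab _ _ p'J q'J) + E']]] := double_coset_conj aJ qJ rJ kJ E.
  (* The conjugate of [r] is 1, which [cox_neq] forbids, or [s], which makes two alternating
     products of length k + 1 < m equal. *)
  rewrite E' -def_z => -[] Ez.
    apply: (@cox_neq _ _ cox r z); first exact: JS.
    by apply: (@mulgI _ z^-1%g); rewrite mulVg mulgA.
  have : (r * z = z * s)%g by rewrite -Ez !mulgA mulgV mul1g.
  rewrite def_z wprod_cat -mulgA spC !mulgA => /mulIg.
  rewrite -wprod_altword -wprod_altwordr => /esym.
  by apply: (braid_neq cox st); clear -km; lia.
have c0 := chain [::] (or_introl erefl); have cs := chain [:: s] (or_intror erefl).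
rewrite big_nil mul1g in c0; rewrite big_seq1 in cs.
rewrite /braid_defect -(prednK m0) word_act_altwordr word_act_altword.
rewrite rho_comm_minimal // linearD !linearZ /= c0 cs.
set x := wprod (altword t s m.-1); set r := letter t s m.-1; set w := (x * b * _)%g.
have rx : (r * x = x * s)%g.
  by rewrite -wprod_altword -wprod_altwordr prednK //; case: st.
have rJ : r \in pred2 s t by apply: letterJ.
have aJ : all [in pred2 s t] (altword t s m.-1) by apply: all_altword.
have xr : (x^-1 * r = s * x^-1)%g.
  by apply: (@mulIg _ x); rewrite mulgVK -mulgA rx mulKg.
have rw : (r * w = x * (s * b) * star x^-1)%g by rewrite /w !mulgA rx.
have wr : (w * star r = x * (s * b) * star x^-1)%g.
  by rewrite -mulgA -gmulfM xr gmulfM sb !mulgA.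
have wI : w \in I by apply: (twisted_conj starK).
rewrite rho_comm ?JS // ?rw ?wr //; first by lmodule R.
(* It remains to see that [r] lengthens [w]. Otherwise exchange would write [s * x^-1], of length
   [m], with fewer than [m] letters. *)
rewrite -rw; have [->|E] := len_descent cox w (JS rJ); first by [].
have rm : reduced S (r :: altword t s m.-1).
  by have := braid_reduced cox ts (leqnn m); rewrite -{1}(prednK m0).
have [||||q [qJ qm E']] :=
    @star_exchange _ _ star cox starK starS _ JS r (x * b)%g (rev (altword t s m.-1)).
- by rewrite JS.
- by rewrite all_rev.
- rewrite mulgA -(big_cons _ _ r (altword t s m.-1) xpredT idfun) !bmin //= ?rJ //.
  exact: (reduced_behead cox rm).
- by rewrite (wprod_rev cox) ?(all_JS JS) // -/w E.
move: E'; rewrite (wprod_rev cox) ?(all_JS JS) // -/x -/w rw.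
rewrite -wr /w -mulgA -gmulfM xr => /mulgI /(congr1 star); rewrite !starK => sx.
have := len_wprod cox (all_JS JS qJ); rewrite -sx.
have -> : len (s * x^-1)%g = m.
  rewrite -(lenV cox) invgM invgK sS' -wprod_altwordr prednK //.
  exact: (braid_len cox st).
by move: qm; rewrite size_rev size_altword; clear; lia.
Qed.

End BraidAtMinimal.

(** [twisted_swap] makes the two mixed equations equivalent, which leaves four cases up to
    symmetry. *)
Lemma braid_defect_minimal s t m b : braid_pair S s t m -> b \in I ->
  coset_minimal S (pred2 s t) b -> braid_defect rho s t m (a b) = 0.
Proof.
move=> st bI bmin; have [sS tS _ _] := st.
have sw := twisted_swap cox starK starS bI.
have sJ : s \in pred2 s t by rewrite !inE eqxx.
have tJ : t \in pred2 s t by rewrite !inE eqxx orbT.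
have [sbt|sbt] := eqVneq (s * b)%g (b * star t)%g.
  by apply: (braid_defect_swap st bI bmin) => //; apply: sw.
have tbs : (t * b <> b * star s)%g by move=> /(sw _ _ tS sS)/eqP; apply/negP.
have [sbs|sbs] := eqVneq (s * b)%g (b * star s)%g.
  have [tbt|tbt] := eqVneq (t * b)%g (b * star t)%g.
    exact: (braid_defect_comm st bI bmin).
  apply: (braid_defect_half st bI bmin sbs) => r.
  by case/orP=> /eqP -> //; apply/eqP.
have [tbt|tbt] := eqVneq (t * b)%g (b * star t)%g.
  (* The preceding case with [s] and [t] exchanged; the defect changes sign. *)
  have bmin' : coset_minimal S (pred2 t s) b.
    move=> q qJ; apply: bmin; rewrite -(eq_all (a1 := [in pred2 t s])) // => x.
    by rewrite !inE orbC.
  have := @braid_defect_half t s m b (braid_pairC st) bI bmin' tbt.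
  rewrite /braid_defect => /(_ _)/eqP; rewrite subr_eq0 => D0.
  apply/eqP; rewrite subr_eq0 eq_sym; apply: D0 => r.
  by case/orP=> /eqP ->; apply/eqP.
apply: (braid_defect_free st bI bmin) => r r'.
by case/orP=> /eqP -> /orP[]/eqP -> //; apply/eqP.
Qed.

Hypothesis u1_regular : forall v : M, (u + 1) *: v = 0 -> v = 0.

Lemma braid_defect_twisted s t m w : braid_pair S s t m -> w \in I ->
  braid_defect rho s t m (a w) = 0.
Proof.
move=> st; have [sS tS _ _] := st.
have JS : {subset pred2 s t <= S} by move=> r; rewrite inE => /orP[]/eqP ->.
have [n] := ubnP (len w); elim: n w => // n IHn w lw wI.
have [[r [rJ lr]]|wmin] := pselect (exists r, r \in pred2 s t /\ (len (r * w)%g < len w)%N).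
  have rS := JS r rJ.
  have stable := @braid_defect_stable R W S M (u ^+ 2) rho rho_quad s t sS tS r m _ rJ.
  have [rwC|rwC] := eqVneq (r * w)%g (w * star r)%g.
    have rwI : (r * w)%g \in I by apply: (twisted_mul cox).
    have /IHn/(_ rwI) D0 : (len (r * w)%g < n)%N by clear -lw lr; lia.
    (* By (i), [rho r] takes [a (r * w)] to a combination in which [a w] has coefficient u + 1, and
       the defect of the other term is already zero. *)
    have := stable _ D0; rewrite rho_comm ?(cox_mulK cox) //; last first.
      by rewrite {1}rwC -mulgA -gmulfM (cox_invol cox) // multiplicative1 mulg1.
    move: D0; rewrite /braid_defect => /eqP; rewrite subr_eq0 => /eqP D0.
    rewrite !linearD !linearZ /= D0 => D1; apply: u1_regular.
    by rewrite -[RHS]D1; lmodule R.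
  set w' := (r * w * star r)%g.
  have w'I : w' \in I by apply: (twisted_conj_gen cox).
  have lw' := twisted_down cox starK starS rS wI (elimN eqP rwC) lr.
  have /IHn/(_ w'I) D0 : (len w' < n)%N by move: lw; rewrite lw' !ltnS => /ltnW.
  have rw' : (r * w' = w * star r)%g by rewrite /w' !mulgA (cox_invol cox) // mul1g.
  have w'r : (w' * star r = r * w)%g.
    by rewrite /w' -mulgA -gmulfM (cox_invol cox) // multiplicative1 mulg1.
  have := stable _ D0; rewrite rho_noncomm // ?rw' ?w'r.
  - by rewrite -mulgA -gmulfM (cox_invol cox) // multiplicative1 mulg1.
  - by move=> /esym/eqP; apply/negP.
  rewrite (twisted_len_right cox starK) //.
  by have := len_descent cox w rS; rewrite lw' -/w' => -[->|[<-]] //; rewrite ltnW // ltnW.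
apply: braid_defect_minimal => //; apply: (coset_minimal_descent cox JS) => r rJ.
have [->|E] := len_descent cox w (JS r rJ); first by [].
by case: wmin; exists r; rewrite rJ E.
Qed.

Lemma word_act_braid s t m v : braid_pair S s t m ->
  (forall x : M, exists (r : seq W) (c : W -> R),
     {subset r <= I} /\ x = \sum_(i <- r) c i *: a i) ->
  word_act rho (altword s t m) v = word_act rho (altword t s m) v.
Proof.
move=> st /(_ v) [r [c [rI ->]]]; rewrite !linear_sum big_seq [RHS]big_seq.
apply: eq_bigr => w /rI wI; rewrite !linearZ /=; congr (_ *: _).
by apply/eqP; rewrite -subr_eq0; apply/eqP; apply: braid_defect_twisted.
Qed.

End BraidRelation.

(** * Matsumoto's theorem *)

Section Matsumoto.
Local Open Scope group_scope.
Variables (W : groupType) (S : {pred W}).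
Hypothesis cox : coxeter_system S.

Local Notation len := (cox_length S).
Local Notation wprod r := (\prod_(x <- r) x).

(** Since lengths add along [wprod p0 * b], the first letter [r] is a left descent of [wprod p0]
    itself, which therefore has a reduced word beginning with [r]. *)
Lemma reduced_change_word J p0 b r p : {subset J <= S} -> coset_minimal S J b ->
  all [in J] p0 -> reduced S p0 -> r \in J -> reduced S (r :: p) ->
  wprod (r :: p) = wprod p0 * b ->
  exists p1, [/\ all [in J] p1, reduced S (r :: p1), wprod (r :: p1) = wprod p0,
    wprod p = wprod p1 * b & len (wprod p1 * b) = (size p1 + len b)%N].
Proof.
move=> JS bmin p0J rp0 rJ rp E; have rS := JS r rJ.
have [|p1 [p1J rp1 E1]] := parabolic_reduced cox JS (p := r :: p0); first by rewrite /= rJ.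
rewrite big_cons in E1.
have E1' : r * wprod p1 = wprod p0 by rewrite E1 (cox_mulK cox).
have Ep : wprod p = wprod p1 * b.
  by rewrite E1 -mulgA -E big_cons (cox_mulK cox).
exists p1; split=> //; rewrite ?big_cons ?bmin //.
apply: reduced_cons => //; rewrite E1' E1.
have [E2|->] := len_descent cox (wprod p0) rS; last by [].
have lt := reduced_consW cox rp; rewrite -(big_cons _ _ r p xpredT idfun) E Ep E1 -mulgA in lt.
have rrp0 : reduced S (r :: p0) by apply: reduced_cons; rewrite // E2.
have := bmin (r :: p0); rewrite /= rJ p0J big_cons -mulgA => /(_ isT rrp0).
by move: lt => /[swap] ->; rewrite bmin //= addSn ltnNge leqnSn.
Qed.

(** Induction on length. If the first letters s and t differ, the induction hypothesis lets both
    tails end in one word for the shortest element of the <s, t> coset; what stands in front is then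
    the two alternating words, related by a braid relation. *)
Lemma matsumoto (X : Type) (f : W -> X -> X) :
  (forall s t m x, braid_pair S s t m ->
     foldr f x (altword s t m) = foldr f x (altword t s m)) ->
  forall p q x, reduced S p -> reduced S q -> wprod p = wprod q ->
  foldr f x p = foldr f x q.
Proof.
move=> braid p q x; have [n] := ubnP (size p).
elim: n p q x => // n IHn p q x szp rp rq E.
case: p q szp rp rq E => [|s p] [|t q] //= szp rp rq E.
- by have [_] := reducedP rp; have [_] := reducedP rq; rewrite E => ->.
- by have [_] := reducedP rp; have [_] := reducedP rq; rewrite E => ->.
have [[/andP[sS _] lp] [/andP[tS _] lq]] := (reducedP rp, reducedP rq).
have [rp' rq'] := (reduced_behead cox rp, reduced_behead cox rq).
have [st|st] := eqVneq s t.
  subst t; rewrite (IHn p q) //.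
  by move: E; rewrite !big_cons => /mulgI.
have JS : {subset pred2 s t <= S} by move=> r; rewrite inE => /orP[]/eqP ->.
have sJ : s \in pred2 s t by rewrite !inE eqxx.
have tJ : t \in pred2 s t by rewrite !inE eqxx orbT.
have [p0 [b [p0J rp0 def_w bmin]]] := coset_decomposition cox JS (wprod (s :: p)).
have [p1 [p1J rp1 E1 Ep l1]] := reduced_change_word JS bmin p0J rp0 sJ rp def_w.
rewrite E in def_w.
have [q1 [q1J rq1 E2 Eq l2]] := reduced_change_word JS bmin p0J rp0 tJ rq def_w.
have [c rc cb] := reduced_word cox b; have [cS lc] := reducedP rc.
have cat_c r : all [in pred2 s t] r -> len (wprod r * b) = (size r + len b)%N ->
    reduced S (r ++ c) /\ wprod (r ++ c) = wprod r * b.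
  move=> rJ lr; rewrite /reduced all_cat (all_JS JS rJ) cS wprod_cat cb lr.
  by rewrite size_cat -lc cb eqxx.
have [rp1c Ep1c] := cat_c _ p1J l1; have [rq1c Eq1c] := cat_c _ q1J l2.
have szq : (size q < n)%N.
  by move: lp; rewrite E lq => -[->].
rewrite (IHn p (p1 ++ c)) ?Ep1c // (IHn q (q1 ++ c)) ?Eq1c //.
rewrite !foldr_cat -/(foldr f _ (s :: p1)) -/(foldr f _ (t :: q1)).
have sz : size p1 = size q1.
  have [_ l1'] := reducedP rp1; have [_ l2'] := reducedP rq1.
  by move: l1'; rewrite E1 -E2 l2' => -[].
have ap := reduced_alternating cox rp1; have aq := reduced_alternating cox rq1.
have /ap{}ap : all [in pred2 s t] (s :: p1) by rewrite /= sJ.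
have /aq{}aq : all [in pred2 s t] (t :: q1) by rewrite /= tJ.
have ne : s :: p1 <> t :: q1 by case=> /eqP; rewrite (negPf st).
move: ne rp1 rq1; rewrite -E2 in E1; move: E1.
have szq1 : size (t :: q1) = size (s :: p1) by rewrite /= sz.
rewrite szq1 in aq; move: (size (s :: p1)) ap aq => k.
case=> -> [] -> // E1 _ r1 r2; last symmetry;
  by apply: braid; split.
Qed.

End Matsumoto.

(** * The operators on M *)

Section BasisExtension.
Local Open Scope ring_scope.
Variables (R : nzRingType) (V : lmodType R) (I : eqType) (D : {pred I}) (b : I -> V).
Hypothesis bB : basis_on D b.

(** Merges repeated indices, since [basis_free] concerns duplicate-free lists. *)
Lemma sum_collect (N : lmodType R) (h : I -> N) (s : seq (R * I)) :
  \sum_(p <- s) p.1 *: h p.2 =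
  \sum_(i <- undup (unzip2 s)) (\sum_(p <- s | p.2 == i) p.1) *: h i.
Proof.
under [RHS]eq_bigr => i _ do rewrite scaler_suml big_mkcond.
rewrite exchange_big /= big_seq [RHS]big_seq; apply: eq_bigr => p ps.
have pu : p.2 \in undup (unzip2 s) by rewrite mem_undup map_f.
rewrite (bigD1_seq p.2) ?undup_uniq //= eqxx big1 ?addr0 // => i.
by rewrite eq_sym => /negPf ->.
Qed.

(** In the form of lists of pairs, expansions can be concatenated. *)
Lemma basis_span_pairs v : exists s : seq (R * I),
  {subset unzip2 s <= D} /\ v = \sum_(p <- s) p.1 *: b p.2.
Proof.
have [r [c [rD ->]]] := basis_span bB v; exists [seq (c i, i) | i <- r].
by rewrite /unzip2 -map_comp map_id big_map.
Qed.

Lemma basis_span_uniq v : exists (r : seq I) (c : I -> R),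
  [/\ uniq r, {subset r <= D} & v = \sum_(i <- r) c i *: b i].
Proof.
have [s [sD ->]] := basis_span_pairs v; rewrite sum_collect.
exists (undup (unzip2 s)), (fun i => \sum_(p <- s | p.2 == i) p.1).
by split=> // [|i]; rewrite ?undup_uniq // mem_undup; apply: sD.
Qed.

Lemma basis_ind (P : V -> Prop) : P 0 -> (forall i, i \in D -> P (b i)) ->
  (forall c x y, P x -> P y -> P (c *: x + y)) -> forall v, P v.
Proof.
move=> P0 Pb PD v; have [r [c [rD ->]]] := basis_span bB v.
elim: r rD => [|i r IHr] rD; first by rewrite big_nil.
rewrite big_cons; apply: PD; first by apply: Pb; apply: rD; rewrite mem_head.
by apply: IHr => j jr; apply: rD; rewrite inE jr orbT.
Qed.

Lemma basis_scale_eq0 (k : R) (v : V) : (forall c, k * c = 0 -> c = 0) -> k *: v = 0 -> v = 0.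
Proof.
move=> k_reg; have [r [c [ur rD ->]]] := basis_span_uniq v.
rewrite scaler_sumr; under eq_bigr => i _ do rewrite scalerA.
move=> /(basis_free bB ur rD) kc0; rewrite big_seq big1 // => i /kc0/k_reg ->.
by rewrite scale0r.
Qed.

Lemma basis_relation (N : lmodType R) (g : I -> N) (s : seq (R * I)) :
  {subset unzip2 s <= D} -> \sum_(p <- s) p.1 *: b p.2 = 0 ->
  \sum_(p <- s) p.1 *: g p.2 = 0.
Proof.
move=> sD; rewrite !sum_collect => s0.
rewrite big_seq big1 // => i ir.
rewrite (basis_free bB (undup_uniq _) _ s0 ir) ?scale0r // => j.
by rewrite mem_undup; apply: sD.
Qed.

(** A chosen expansion of each vector defines the map; it is linear because [basis_relation]
    transfers every relation among the [b i] to the [g i]. *)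
Lemma basis_extension (N : lmodType R) (g : I -> N) :
  exists f : {linear V -> N}, forall i, i \in D -> f (b i) = g i.
Proof.
pose s v := projT1 (cid (basis_span_pairs v)).
have sD v : {subset unzip2 (s v) <= D} by case: (projT2 (cid (basis_span_pairs v))).
have sE v : \sum_(p <- s v) p.1 *: b p.2 = v.
  by case: (projT2 (cid (basis_span_pairs v))).
pose f v := \sum_(p <- s v) p.1 *: g p.2.
pose scale (c : R) (r : seq (R * I)) := [seq (c * p.1, p.2) | p <- r].
have scaleE c r (N' : lmodType R) (h : I -> N') :
    \sum_(p <- scale c r) p.1 *: h p.2 = c *: \sum_(p <- r) p.1 *: h p.2.
  by rewrite big_map scaler_sumr; apply: eq_bigr => p _; rewrite scalerA.
have scaleD c r : {subset unzip2 r <= D} -> {subset unzip2 (scale c r) <= D}.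
  by move=> rD i; rewrite /unzip2 -map_comp; apply: rD.
have f_lin : linear f.
  move=> c x y; apply/eqP; rewrite -subr_eq0; apply/eqP.
  rewrite /f -scaleE -big_cat -scaleN1r -scaleE -big_cat /=.
  apply: basis_relation => [i|].
    rewrite /unzip2 map_cat mem_cat => /orP[/sD //|].
    apply: (scaleD) => {}i; rewrite /unzip2 map_cat mem_cat => /orP[|/sD //].
    by apply: scaleD; apply: sD.
  by rewrite big_cat /= scaleE big_cat /= scaleE !sE scaleN1r subrr.
pose F : {linear V -> N} := HB.pack f (GRing.isLinear.Build R V N *:%R f f_lin).
exists F => i iD; apply/eqP; rewrite -subr_eq0 /= /f.
have := @basis_relation N g ((- 1, i) :: s (b i)).
rewrite !big_cons /= sE !scaleN1r addNr addrC => -> // j; rewrite inE.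
by case/predU1P => [->|/sD].
Qed.

End BasisExtension.

(** * The operators of formulas (i) to (iv) *)

Section TwistedGenerators.
Local Open Scope ring_scope.
Variables (W : groupType) (S : {pred W}) (star : {multiplicative W -> W}).
Hypothesis cox : coxeter_system S.
Hypothesis starK : forall w, star (star w) = w.
Hypothesis starS : forall s, s \in S -> star s \in S.
Variables (R : comNzRingType) (M : lmodType R) (u : R) (a : W -> M).

Local Notation len := (cox_length S).
Local Notation I := (twisted_involution star).

Hypothesis aB : basis_on I a.

(** Comparing lengths gives boolean tests; between [w] and [s * w] this agrees with the Bruhat order
    by [bruhat_lt_len] and [bruhat_lt_mul]. *)
Definition twisted_gen (s w : W) : M :=
  if (s * w == w * star s)%g then
    if (len w < len (s * w)%g)%N then u *: a w + (u + 1) *: a (s * w)%g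
    else (u ^+ 2 - u - 1) *: a w + (u ^+ 2 - u) *: a (s * w)%g
  else
    if (len w < len (s * w)%g)%N then a (s * w * star s)%g
    else (u ^+ 2 - 1) *: a w + u ^+ 2 *: a (s * w * star s)%g.

Definition twisted_op (s : W) : {linear M -> M} :=
  projT1 (cid (basis_extension aB (twisted_gen s))).

Lemma twisted_opE s w : w \in I -> twisted_op s (a w) = twisted_gen s w.
Proof. exact: (projT2 (cid (basis_extension aB (twisted_gen s)))). Qed.

(** The span of [a w] together with [a (s * w)] or [a (s * w * star s)] is stable, and the relation
    is checked there in each of the four cases. *)
Lemma twisted_op_quad s v : s \in S ->
  twisted_op s (twisted_op s v) = (u ^+ 2 - 1) *: twisted_op s v + u ^+ 2 *: v.
Proof.
move=> sS; elim/(basis_ind aB): v => [|w wI|c x y Ex Ey]; first by rewrite !linear0 ?scaler0 addr0.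
  rewrite twisted_opE // /twisted_gen.
  have [E|/eqP NE] := eqVneq (s * w)%g (w * star s)%g.
    have swI : (s * w)%g \in I by apply: (twisted_mul cox).
    have E' : (s * (s * w) == s * w * star s)%g by rewrite -(mulgA s w) -E.
    have /eqP Eb := E.
    case: ltnP => lw; rewrite linearD !linearZ /= !twisted_opE // /twisted_gen E' Eb
      (cox_mulK cox) //.
    - by rewrite lw (ltnNge (len (s * w)%g)) (ltnW lw) /=; lmodule R.
    have [lt|lt] := len_descent cox w sS; first by move: lw; rewrite lt ltnn.
    by rewrite (ltnNge (len w)) lw /= lt ltnSn; lmodule R.
  set w' := (s * w * star s)%g.
  have w'I : w' \in I by apply: (twisted_conj_gen cox).
  have sw' : (s * w' = w * star s)%g by rewrite /w' !mulgA (cox_invol cox) // mul1g.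
  have starss : (star s * star s)%g = 1%g by rewrite -gmulfM (cox_invol cox) // multiplicative1.
  have w'r : (w' * star s = s * w)%g by rewrite /w' -mulgA starss mulg1.
  have sw's : (s * w' * star s = w)%g by rewrite sw' -mulgA starss mulg1.
  have NE' : (s * w' == w' * star s)%g = false.
    by rewrite sw' w'r; apply/eqP => /esym.
  have lr : len (s * w')%g = len (s * w)%g by rewrite sw' (twisted_len_right cox starK).
  case: ltnP => lw; rewrite ?linearD ?linearZ /= !twisted_opE // /twisted_gen NE' sw's lr.
    have lw' := twisted_up cox starK starS sS wI NE lw.
    have := len_descent cox w sS; rewrite -/w' in lw'; rewrite lw'.
    case=> E; last by move: lw; rewrite E ltnNge leqnSn.
    by rewrite E ltnNge leqnSn.
  have [E|E] := len_descent cox w sS; first by move: lw; rewrite E ltnn.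
  have lw' : len w = (len w').+2 by apply: (twisted_down cox starK starS); rewrite // E.
  move/eqP/negPf: (NE) => ->; rewrite ltnNge lw /= -/w'.
  by move: E; rewrite lw' => -[<-]; rewrite ltnSn; lmodule R.
by rewrite !linearP /= Ex Ey; lmodule R.
Qed.


Hypothesis u1_regular : forall c : R, (u + 1) * c = 0 -> c = 0.

Lemma twisted_word_reduced p q v : reduced S p -> reduced S q ->
  (\prod_(x <- p) x = \prod_(x <- q) x)%g ->
  word_act twisted_op p v = word_act twisted_op q v.
Proof.
move=> rp rq E; apply: (matsumoto cox) rp rq E => s t m x st.
apply: (word_act_braid cox starK starS twisted_op_quad _ _ _ x st (basis_span aB)).
- move=> r w rS wI /eqP E lw; rewrite twisted_opE // /twisted_gen.
  by rewrite E lw.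
- move=> r w rS wI /eqP/negPf E lw; rewrite twisted_opE // /twisted_gen.
  by rewrite E lw.
by move=> y; apply: (basis_scale_eq0 aB).
Qed.

End TwistedGenerators.

(** * The action of the Hecke algebra *)

Local Open Scope ring_scope.

(** In the field of fractions u + 1 is nonzero, because its coefficient at X is 1. *)
Lemma laurent_u1_regular (c : laurent) : (laurent_u + 1) * c = 0 -> c = 0.
Proof.
move=> /(congr1 val); rewrite rmorphM rmorphD rmorph1 rmorph0 /= => /eqP.
rewrite mulf_eq0 => /orP[|/eqP c0]; last by apply: val_inj; rewrite /= c0.
rewrite -tofrac1 -tofracD tofrac_eq0 => /eqP/(congr1 (fun p : {poly int} => p`_1)).
by rewrite coefD coefX coef1 coef0.
Qed.

(** * Simple reflections and the Bruhat order *)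

Section BruhatCover.
Variables (W : groupType) (S : {pred W}).
Hypothesis cox : coxeter_system S.

Lemma bruhat_lt_len x y : bruhat_lt S x y -> (cox_length S x < cox_length S y)%N.
Proof.
case=> xy; have : x = y \/ (cox_length S x < cox_length S y)%N; last by case.
elim: xy => {x y} [x y [_ lt]|x|x y z _ [->|xy] _ [<-|yz]];
  [right|left|left|right|right|right] => //.
exact: ltn_trans yz.
Qed.

Lemma bruhat_lt_mul s w : s \in S -> (cox_length S w < cox_length S (s * w)%g)%N ->
  bruhat_lt S w (s * w)%g.
Proof.
move=> sS lt; split; last by move=> /esym; apply: (cox_neq cox).
(* Bruhat steps multiply on the right, so the reflection is the conjugate of [s] by [w^-1]. *)
apply: rt_step; split=> //; exists (w^-1 * s * w)%g; last by rewrite !mulgA mulgV mul1g.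
by exists w^-1%g, s; rewrite invgK.
Qed.

Lemma bruhat_lt_mulV s w : s \in S -> (cox_length S (s * w)%g < cox_length S w)%N ->
  bruhat_lt S (s * w)%g w.
Proof.
by move=> sS lt; have := @bruhat_lt_mul s (s * w)%g sS; rewrite (cox_mulK cox) //; apply.
Qed.

End BruhatCover.

(** * The module structure on M *)

Section HeckeAction.
Variables (W : groupType) (S : {pred W}) (H : algType laurent) (T : W -> H).
Hypotheses (cox : coxeter_system S) (heck : hecke_algebra S T).
Variables (M : lmodType laurent) (rho : W -> {linear M -> M}).
Local Notation u := laurent_u.
Local Notation len := (cox_length S).

Hypothesis rho_quad : forall s v, s \in S ->
  rho s (rho s v) = (u ^+ 2 - 1) *: rho s v + u ^+ 2 *: v.
Hypothesis rho_reduced : forall p q v, reduced S p -> reduced S q ->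
  (\prod_(x <- p) x = \prod_(x <- q) x)%g -> word_act rho p v = word_act rho q v.

Let TB := hecke_basis heck.

Lemma hecke_ind (P : W -> Prop) : P 1%g ->
  (forall s w, s \in S -> len (s * w)%g = (len w).+1 -> P w -> P (s * w)%g) ->
  forall w, P w.
Proof.
move=> P1 PS w; have [p rp <-] := reduced_word cox w.
elim: p rp => [|s p IHp] rsp; first by rewrite big_nil.
have rp := reduced_behead cox rsp; have [/andP[sS _] ls] := reducedP rsp.
rewrite big_cons in ls *; apply: PS (IHp rp) => //.
by have [_ ->] := reducedP rp.
Qed.

Lemma hecke_mulT s w : s \in S -> len (s * w)%g = (len w).+1 ->
  T s * T w = T (s * w)%g.
Proof. by move=> sS l; apply: (hecke_mul heck); rewrite (len_gen cox sS) l. Qed.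

Lemma hecke_sqr s : s \in S -> T s * T s = (u ^+ 2 - 1) *: T s + (u ^+ 2) *: 1.
Proof.
move=> /(hecke_quadratic heck); rewrite mulrBr mulr_algr mulrDl mul1r.
move/(canRL (subrK _)); rewrite add0r => /(canRL (addrK _)) ->.
by rewrite scalerDr scalerBl scale1r addrAC.
Qed.

Let word w := projT1 (cid2 (reduced_word cox w)).
Let word_reduced w : reduced S (word w).
Proof. by rewrite /word; case: cid2. Qed.
Let wprod_word w : (\prod_(x <- word w) x)%g = w.
Proof. by rewrite /word; case: cid2. Qed.

(** The action is extended linearly in the algebra variable for fixed [m]; linearity in [m] is
    [hecke_act_linear]. *)
Definition basis_act (m : M) : {linear H -> M} :=
  projT1 (cid (basis_extension TB (fun w => word_act rho (word w) m))).

Definition hecke_act (h : H) (m : M) : M := basis_act m h.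

Lemma hecke_actT w m : hecke_act (T w) m = word_act rho (word w) m.
Proof.
exact: (projT2 (cid (basis_extension TB (fun w => word_act rho (word w) m)))).
Qed.

Lemma hecke_act_is_linear m : linear (hecke_act ^~ m).
Proof. by move=> c x y; rewrite /hecke_act linearP. Qed.

Lemma hecke_act_word p m : reduced S p ->
  hecke_act (T (\prod_(x <- p) x)%g) m = word_act rho p m.
Proof. by move=> rp; rewrite hecke_actT; apply: rho_reduced. Qed.

Lemma hecke_act1 m : hecke_act 1 m = m.
Proof.
rewrite -(hecke_one heck) -(big_nil 1%g *%g xpredT (idfun : W -> W)).
by rewrite hecke_act_word // /reduced /= big_nil (len1 cox).
Qed.

Lemma hecke_actS s w m : s \in S -> len (s * w)%g = (len w).+1 ->
  hecke_act (T (s * w)%g) m = rho s (hecke_act (T w) m).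
Proof.
move=> sS l; rewrite -{1}(wprod_word w) -(big_cons _ _ s (word w) xpredT idfun).
rewrite hecke_act_word ?hecke_actT //; apply: reduced_cons => //.
by rewrite wprod_word l.
Qed.

Lemma hecke_act_gen s m : s \in S -> hecke_act (T s) m = rho s m.
Proof.
move=> sS; have := @hecke_actS s 1%g m sS.
by rewrite mulg1 (len_gen cox sS) (len1 cox) (hecke_one heck) hecke_act1; apply.
Qed.

(** When [s] shortens [w], T w is T s times T (s w), and the quadratic relations of [T s] and
    [rho s] match. *)
Lemma hecke_act_mulT s h m : s \in S -> hecke_act (T s * h) m = rho s (hecke_act h m).
Proof.
move=> sS; elim/(basis_ind TB): h => [|w _|c x y Ex Ey].
- by rewrite mulr0 /hecke_act !linear0.
- have [l|l] := len_descent cox w sS; first by rewrite hecke_mulT // hecke_actS.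
  have l' : len (s * (s * w))%g = (len (s * w)%g).+1 by rewrite (cox_mulK cox).
  rewrite -[w in T s * T w](cox_mulK cox w sS) -hecke_mulT // mulrA hecke_sqr //.
  rewrite mulrDl -!scalerAl mul1r hecke_mulT // (cox_mulK cox) //.
  rewrite {1}/hecke_act linearD !linearZ /= -!/(hecke_act _ _).
  have -> : hecke_act (T w) m = rho s (hecke_act (T (s * w)%g) m).
    by rewrite -hecke_actS // (cox_mulK cox).
  by rewrite rho_quad.
by rewrite mulrDr -scalerAr !hecke_act_is_linear Ex Ey linearP.
Qed.

Lemma hecke_act_linear h : linear (hecke_act h).
Proof.
move=> c x y; elim/(basis_ind TB): h => [|w _|d h h' Eh Eh'].
- by rewrite /hecke_act !linear0 ?scaler0 addr0.
- by rewrite !hecke_actT linearP.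
rewrite !hecke_act_is_linear Eh Eh' !scalerDr !scalerA [d * c]mulrC.
by rewrite -!addrA; congr (_ + _); rewrite addrCA.
Qed.

Lemma hecke_act_mul h h' m : hecke_act (h * h') m = hecke_act h (hecke_act h' m).
Proof.
elim/(basis_ind TB): h => [|w _|c x y Ex Ey].
- by rewrite mul0r /hecke_act !linear0.
- elim/hecke_ind: w => [|s w sS l IHw]; first by rewrite (hecke_one heck) mul1r hecke_act1.
  by rewrite -hecke_mulT // -mulrA !(hecke_act_mulT _ _ sS) IHw.
by rewrite mulrDl -scalerAl !hecke_act_is_linear Ex Ey.
Qed.

Lemma hecke_act_module : module_structure hecke_act.
Proof.
split.
- by move=> h h' m; rewrite -[h]scale1r hecke_act_is_linear !scale1r.
- by move=> h m m'; rewrite -[m]scale1r hecke_act_linear !scale1r.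
- exact: hecke_act_mul.
by move=> c m; rewrite -[c%:A]addr0 hecke_act_is_linear hecke_act1 /hecke_act linear0 addr0.
Qed.

(** The [T s] generate the algebra, by [hecke_ind] and [hecke_mulT]. *)
Lemma hecke_act_unique (act : H -> M -> M) : module_structure act ->
  (forall s v, s \in S -> act (T s) v = rho s v) -> hecke_act = act.
Proof.
move=> actM act_gen; apply/funext => h; apply/funext => m.
have act_lin c x y : act (c *: x + y) m = c *: act x m + act y m.
  by rewrite (module_addl actM) -mulr_algl (module_mul actM) (module_scale actM).
elim/(basis_ind TB): h => [|w _|c x y Ex Ey].
- have := act_lin (-1) 0 0; rewrite scaler0 addr0 scaleN1r addNr => ->.
  by rewrite /hecke_act linear0.
- elim/hecke_ind: w => [|s w sS l IHw].
    by rewrite (hecke_one heck) hecke_act1 -[1]scale1r (module_scale actM) scale1r.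
  by rewrite -hecke_mulT // hecke_act_mulT // IHw (module_mul actM) (act_gen s).
by rewrite hecke_act_is_linear act_lin Ex Ey.
Qed.

End HeckeAction.

Theorem theorem0p1 (W : groupType) (S : {pred W})
    (star : {multiplicative W -> W})
    (H : algType laurent) (T : W -> H)
    (M : lmodType laurent) (a : W -> M) (u := laurent_u) :
  coxeter_system S ->
  (forall w, star (star w) = w) ->
  (forall s, s \in S -> star s \in S) ->
  hecke_algebra S T ->
  basis_on (twisted_involution star) a ->
  exists! act : H -> M -> M,
    module_structure act /\
    forall s w : W, s \in S -> w \in twisted_involution star ->
    [/\ (s * w = w * star s)%g -> bruhat_lt S w (s * w)%g ->
          act (T s) (a w) = u *: a w + (u + 1) *: a (s * w)%g,
        (s * w = w * star s)%g -> bruhat_lt S (s * w)%g w ->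
          act (T s) (a w) =
            (u ^+ 2 - u - 1) *: a w + (u ^+ 2 - u) *: a (s * w)%g,
        (s * w <> w * star s)%g -> bruhat_lt S w (s * w)%g ->
          act (T s) (a w) = a (s * w * star s)%g
      & (s * w <> w * star s)%g -> bruhat_lt S (s * w)%g w ->
          act (T s) (a w) =
            (u ^+ 2 - 1) *: a w + u ^+ 2 *: a (s * w * star s)%g].
Proof.
move=> cox starK starS heck aB.
have quad := twisted_op_quad cox starK starS u aB.
have red := twisted_word_reduced cox starK starS aB laurent_u1_regular.
exists (hecke_act cox heck (twisted_op S u aB)); split.
  split; first exact: hecke_act_module.
  move=> s w sS wI; rewrite hecke_act_gen // twisted_opE // /twisted_gen.
  split=> [/eqP-> /bruhat_lt_len-> //|/eqP-> /bruhat_lt_len lt|/eqP/negPf-> /bruhat_lt_len-> //|].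
    by rewrite ltnNge ltnW.
  by move=> /eqP/negPf-> /bruhat_lt_len lt; rewrite ltnNge ltnW.
move=> act [actM act_gen]; apply: hecke_act_unique => // s v sS.
(* The scalars [c%:A] commute with [T s], so [act (T s)] is linear and determined by its values on
   the basis. *)
have act_lin c x y : act (T s) (c *: x + y) = c *: act (T s) x + act (T s) y.
  rewrite (module_addr actM) -(module_scale actM) -(module_mul actM).
  by rewrite mulr_algr -mulr_algl (module_mul actM) (module_scale actM).
elim/(basis_ind aB): v => [|w wI|c x y Ex Ey]; last by rewrite act_lin linearP Ex Ey.
  have := act_lin (-1) 0 0; rewrite scaler0 addr0 scaleN1r addNr => ->.
  by rewrite linear0.
rewrite twisted_opE // /twisted_gen; have [g1 g2 g3 g4] := act_gen s w sS wI.
have ltsw := bruhat_lt_mul cox sS; have gtsw := bruhat_lt_mulV cox sS.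
have [E|/eqP E] := eqVneq (s * w)%g (w * star s)%g; case: ltnP => lw.
- by apply: g1 => //; apply: ltsw.
- apply: g2 => //; apply: gtsw.
  (* [ltnP] gives only a weak inequality here; [len_descent] excludes equal lengths. *)
  by have [l|->] := len_descent cox w sS; first by move: lw; rewrite l ltnn.
- by apply: g3 => //; apply: ltsw.
apply: g4 => //; apply: gtsw.
by have [l|->] := len_descent cox w sS; first by move: lw; rewrite l ltnn.
Qed.
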